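(* Let $S\in[2\tau\pi/|\varrho|,\infty)$. Then there is a constant $C>0$ depending only on $\tau$, $\varrho$ and $S$ such that $$|\partial_x^\alpha Z_{jk}(x,0)|\le C\,\bigl(|x|\,s(x)\bigr)^{-3/2-|\alpha|/2}$$ for all $x\in\mathbb R^3$ with $|x|\ge S+\tau\pi/|\varrho|$, all $\alpha\in\mathbb N_0^3$ with $|\alpha|\le1$, all $j\in\{1,2,3\}$ and all $k\in\{2,3\}$.
   Context: Fixed parameters: $\tau\in(0,\infty)$, $\varrho\in\mathbb R\setminus\{0\}$; $e_1=(1,0,0)$; $s(x):=1+|x|-x_1$ for $x\in\mathbb R^3$; $|\alpha|=\alpha_1+\alpha_2+\alpha_3$. $\Omega:=\varrho\begin{pmatrix}0&0&0\\0&0&-1\\0&1&0\end{pmatrix}$. Let $N(x):=(4\pi|x|)^{-1}$ for $x\ne0$, $K(x,t):=(4\pi t)^{-3/2}e^{-|x|^2/(4t)}$ for $x\in\mathbb R^3$, $t>0$, and $T_{jk}(x,t):=\delta_{jk}K(x,t)+\partial_j\partial_k\bigl(\int_{\mathbb R^3}N(x-y)K(y,t)\,dy\bigr)$ (derivatives with respect to $x$), $1\le j,k\le3$. With $T=(T_{jk})$, define the $3\times3$ matrix $\Gamma(x,y,t):=T(x-\tau te_1-e^{-t\Omega}y,\,t)\cdot e^{-t\Omega}$ for $x,y\in\mathbb R^3$, $t>0$, and $Z_{jk}(x,y):=\int_0^\infty\Gamma_{jk}(x,y,t)\,dt$ for $x\ne y$, $1\le j,k\le3$ (the integral converges absolutely).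 $Z_{jk}(\cdot,0)$ is $C^1$ on $\mathbb R^3\setminus\{0\}$. *)

(* Defs.v *)
From HB Require Import structures.
From mathcomp Require Import all_boot all_order all_algebra.
From mathcomp Require Import all_classical all_reals all_analysis.

Set Implicit Arguments.
Unset Strict Implicit.
Unset Printing Implicit Defensive.

Import Order.TTheory GRing.Theory Num.Theory.
Import numFieldNormedType.Exports.

Local Open Scope classical_set_scope.
Local Open Scope ring_scope.

(* Points of R^3 are column vectors 'cV[R]_3, with coordinates numbered from 0:
   the paper's x_1, x_2, x_3 are x 0 0, x 1 0, x 2 0. *)

Definition vec3 (R : realType) (a b c : R) : 'cV[R]_3 :=
  \col_(i < 3) [:: a; b; c]`_i.

(* The library norm `|x| on 'cV[R]_3 is the maximum norm. *)
Definition enorm (R : realType) (x : 'cV[R]_3) : R :=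
  Num.sqrt (\sum_(i < 3) x i 0 ^+ 2).

Definition e1 (R : realType) : 'cV[R]_3 := vec3 1 0 0.

Definition wake (R : realType) (x : 'cV[R]_3) : R := 1 + enorm x - x 0 0.

Definition partial (R : realType) (l : 'I_3) (f : 'cV[R]_3 -> R)
    (x : 'cV[R]_3) : R :=
  'D_(delta_mx l 0) f x.

Definition mabs (alpha : 'I_3 -> nat) : nat := (\sum_(l < 3) alpha l)%N.

Definition mpartial (R : realType) (alpha : 'I_3 -> nat) (f : 'cV[R]_3 -> R) :
    'cV[R]_3 -> R :=
  iter (alpha 0) (partial 0)
    (iter (alpha 1) (partial 1) (iter (alpha 2) (partial 2) f)).

Definition mexp (R : realType) (n : nat) (A : 'M[R]_n.+1) : 'M[R]_n.+1 :=
  limn (series (fun k : nat => (k`!%:R)^-1 *: A ^+ k)).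

(* The library has no Lebesgue measure on 'cV[R]_3: integrals over R^3 are taken
   with respect to the product measure on R * R * R, transported by vec3. *)
Definition lebesgue3 (R : realType) :=
  ((@lebesgue_measure R \x @lebesgue_measure R) \x @lebesgue_measure R)%E.

Definition integral3 (R : realType) (f : 'cV[R]_3 -> R) : R :=
  \int[@lebesgue3 R]_y f (vec3 y.1.1 y.1.2 y.2).

Definition Omega (R : realType) (rho : R) : 'M[R]_3 :=
  rho *: \matrix_(i < 3, j < 3)
    (nth [::] [:: [:: 0; 0;  0];
                  [:: 0; 0; -1];
                  [:: 0; 1;  0]] i)`_j.

(* newton 0 = 0, which is immaterial: newton only occurs under an integral. *)
Definition newton (R : realType) (x : 'cV[R]_3) : R := (4 * pi * enorm x)^-1.

Definition heat (R : realType) (x : 'cV[R]_3) (t : R) : R :=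
  (4 * pi * t) `^ (- (3 / 2)) * expR (- (enorm x ^+ 2 / (4 * t))).

Definition Tstokes (R : realType) (x : 'cV[R]_3) (t : R) : 'M[R]_3 :=
  \matrix_(j < 3, k < 3)
    ((j == k)%:R * heat x t +
     partial j (partial k
       (fun z => integral3 (fun y => newton (z - y) * heat y t))) x).

Definition Gamma (R : realType) (tau rho : R) (x y : 'cV[R]_3) (t : R) :
    'M[R]_3 :=
  Tstokes (x - (tau * t) *: e1 R - mexp (- t *: Omega rho) *m y) t
    *m mexp (- t *: Omega rho).

Definition Z (R : realType) (tau rho : R) (j k : 'I_3) (x y : 'cV[R]_3) : R :=
  \int[@lebesgue_measure R]_(t in `]0, +oo[) Gamma tau rho x y t j k.

(* Main.v *)
From HB Require Import structures.
Require Import Defs.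
From mathcomp Require Import all_boot all_order all_algebra.
From mathcomp Require Import all_classical all_reals all_analysis.
From mathcomp Require Import measurable_realfun zify ring lra.
Import Order.TTheory GRing.Theory Num.Theory.
Import numFieldNormedType.Exports.
Local Open Scope classical_set_scope.
Local Open Scope ring_scope.

(* Writing |z|^-1 as an integral of Gaussians, the Newtonian potential of the
   heat kernel is (2 pi^(3/2))^-1 G_0, where
   G_m(z,t) = (4t)^(-m-1/2) int_0^1 v^(2m) exp(- v^2 |z|^2 / (4t)) dv.
   Coordinates and the G_m generate an algebra that is stable under
   differentiation in z and t, and an element of parabolic weight w is
   O((|z|^2 + 4t)^(-w/2)); the entries of T have weight 3.
   For k in {2,3}, Z_jk(x,0) is the integral over t > 0 of
   T(x - tau t e_1, t) against cos(rho t) and sin(rho t). Integrating by parts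
   with primitives of these that vanish at 0 leaves no boundary terms and
   replaces T by its t-derivative along x - tau t e_1, which has weight at
   least 4. For |x| bounded below,
   |x - tau t e_1|^2 + t >= c (|x| s(x) + (tau t - |x|)^2),
   so the remaining integrals reduce to that of
   (|x| s(x) + (tau t - |x|)^2)^-1, which is at most pi / (tau sqrt(|x| s(x))).
   Each x-derivative raises the weight by 1. *)

(** Estimated directly, weight 3 gives only the order -1 in |x| s(x): one factor of the decay is
    worth (|x| s(x))^(-1/2), and integrating the other two gives another -1/2. The missing half
    power comes from the oscillation. It is available for k in {2,3} because e_1 spans the axis of
    the rotation: only the first column of e^(-t Omega) has a nonzero constant entry, whose
    primitive would be unbounded. Along x - tau t e_1 the derivative consists of a transport part -
    tau d_1, which raises the weight by 1, and of d_t, which raises it by 2; the surplus of the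
    latter is absorbed by the lower bound on |x| s(x). Derivatives are never written out:
    expressions are kept as syntax trees, so that differentiation is a recursive function and the
    decay estimate an induction. Differentiating under the integral needs bounds at all points near
    x; the admissible displacements are measured against (|x| s(x))^(1/2), so that the constants do
    not depend on x. *)

Section DerivativeRules.
Context {R : realType}.
Implicit Types (f g : R -> R) (x a b c : R).

(* A copy of is_derive that is not a type class: holes in the rules below are
   then left to unification instead of instance search. *)
Definition has_deriv f x a : Prop := is_derive x 1 f a.

Lemma has_deriv_eq {f x a b} : has_deriv f x a -> a = b -> has_deriv f x b.
Proof. by move=> ? <-. Qed.

Lemma has_derivD {f g x a b} : has_deriv f x a -> has_deriv g x b ->
  has_deriv (fun s => f s + g s) x (a + b).
Proof. exact: is_deriveD. Qed.

Lemma has_derivN {f x a} : has_deriv f x a -> has_deriv (fun s => - f s) x (- a).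
Proof. exact: is_deriveN. Qed.

Lemma has_derivM {f g x a b} : has_deriv f x a -> has_deriv g x b ->
  has_deriv (fun s => f s * g s) x (a * g x + f x * b).
Proof.
move=> df dg; apply: has_deriv_eq (is_deriveM df dg) _.
by rewrite /GRing.scale/=; ring.
Qed.

Lemma has_derivX n {f x a} : has_deriv f x a ->
  has_deriv (fun s => f s ^+ n) x (n%:R * f x ^+ n.-1 * a).
Proof.
move=> df; have -> : (fun s => f s ^+ n) = f ^+ n by rewrite exprfctE.
exact: is_deriveX.
Qed.

Lemma has_deriv_comp {f g x a b} : has_deriv f (g x) a -> has_deriv g x b ->
  has_deriv (fun s => f (g s)) x (a * b).
Proof. exact: is_derive1_comp. Qed.

Lemma has_deriv_cst c x : has_deriv (fun=> c) x 0.
Proof. exact: is_derive_cst. Qed.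

Lemma has_deriv_id x : has_deriv (fun s => s) x 1.
Proof. exact: is_derive_id. Qed.

Lemma has_deriv_expR x : has_deriv expR x (expR x).
Proof. exact: is_derive_expR. Qed.

Lemma has_deriv_atan x : has_deriv atan x (1 + x ^+ 2)^-1.
Proof. exact: is_derive1_atan. Qed.

Lemma has_deriv_sqrt {f x a} : has_deriv f x a -> 0 < f x ->
  has_deriv (fun s => Num.sqrt (f s)) x ((2 * Num.sqrt (f x))^-1 * a).
Proof.
by move=> df f0; apply: (@has_deriv_comp Num.sqrt f) df; exact: is_derive1_sqrt.
Qed.

Lemma has_derivV {f x a} : has_deriv f x a -> f x != 0 ->
  has_deriv (fun s => (f s)^-1) x (- (f x) ^- 2 * a).
Proof. by move=> df f0; exact: is_deriveV. Qed.

Lemma has_deriv_derivable {f x a} : has_deriv f x a -> derivable f x 1.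
Proof. by case. Qed.

Lemma has_deriv_continuous {f x a} : has_deriv f x a -> {for x, continuous f}.
Proof. by move=> [df _]; apply/differentiable_continuous/derivable1_diffP. Qed.

Lemma has_deriv_derive {f x a} : has_deriv f x a -> 'D_1 f x = a.
Proof. by case. Qed.

Lemma has_deriv_derive1 {f x a} : has_deriv f x a -> derive1 f x = a.
Proof. by move=> df; rewrite derive1E (has_deriv_derive df). Qed.

End DerivativeRules.

(** * Gaussian moments *)

Section GaussianMoments.
Context {R : realType}.
Local Notation mu := (@lebesgue_measure R).
Implicit Types (m : nat) (y v : R).

(** The Boys function F_m. *)
Definition gauss_moment m y : R :=
  \int[mu]_(v in `[0, 1]) (v ^+ m.*2 * expR (- (y * v ^+ 2))).

Lemma has_deriv_gauss_integrand m y v :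
  has_deriv (fun y => v ^+ m.*2 * expR (- (y * v ^+ 2))) y
    (- (v ^+ m.+1.*2 * expR (- (y * v ^+ 2)))).
Proof.
apply: has_deriv_eq.
  apply: has_derivM (has_deriv_cst _ _) _.
  apply: has_deriv_comp (has_deriv_expR _) (has_derivN _).
  exact: has_derivM (has_deriv_id _) (has_deriv_cst _ _).
by rewrite doubleS !exprS expr0; ring.
Qed.

Lemma has_deriv_gauss_power m y v :
  has_deriv (fun v => v ^+ m.*2.+1 * expR (- (y * v ^+ 2))) v
    (m.*2.+1%:R * (v ^+ m.*2 * expR (- (y * v ^+ 2))) -
     2 * y * (v ^+ m.+1.*2 * expR (- (y * v ^+ 2)))).
Proof.
apply: has_deriv_eq.
  apply: has_derivM (has_derivX _ (has_deriv_id _)) _.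
  apply: has_deriv_comp (has_deriv_expR _) (has_derivN _).
  exact: has_derivM (has_deriv_cst _ _) (has_derivX _ (has_deriv_id _)).
by rewrite doubleS /= !exprS expr0; ring.
Qed.

Lemma continuous_gauss_integrand m y :
  continuous (fun v => v ^+ m.*2 * expR (- (y * v ^+ 2))).
Proof.
move=> v; apply: has_deriv_continuous.
apply: has_derivM (has_derivX _ (has_deriv_id _)) _.
apply: has_deriv_comp (has_deriv_expR _) (has_derivN _).
exact: has_derivM (has_deriv_cst _ _) (has_derivX _ (has_deriv_id _)).
Qed.

Lemma integrable_gauss_integrand m y :
  mu.-integrable `[0, 1] (EFin \o (fun v => v ^+ m.*2 * expR (- (y * v ^+ 2)))).
Proof.
apply: continuous_compact_integrable; first exact: segment_compact.
exact/continuous_subspaceT/continuous_gauss_integrand.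
Qed.

Lemma gauss_moment_ge0 m y : 0 <= gauss_moment m y.
Proof.
apply: Rintegral_ge0 => v /=; rewrite in_itv/= => /andP[v0 _].
by rewrite mulr_ge0 ?expR_ge0// exprn_ge0.
Qed.

Lemma gauss_momentS_le m y : gauss_moment m.+1 y <= gauss_moment m y.
Proof.
apply: le_Rintegral => //; try exact: integrable_gauss_integrand.
move=> v /=; rewrite in_itv/= => /andP[v0 v1].
rewrite ler_wpM2r ?expR_ge0// doubleS !exprS mulrA ler_piMl ?exprn_ge0//.
by rewrite mulr_ile1.
Qed.

Lemma gauss_moment0_le1 y : 0 <= y -> gauss_moment 0 y <= 1.
Proof.
move=> y0; have <- : \int[mu]_(v in `[0, 1]) (1 : R) = 1.
  rewrite Rintegral_cst//= lebesgue_measure_itv/=. by rewrite lte01 mul1r/= subr0.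
apply: le_Rintegral => //; first exact: (integrable_gauss_integrand 0).
  apply: continuous_compact_integrable; first exact: segment_compact.
  by apply: continuous_subspaceT => ?; exact: cst_continuous.
move=> v _; rewrite expr0 mul1r -expR0 ler_expR oppr_le0.
by rewrite mulr_ge0 ?sqr_ge0.
Qed.

Lemma has_deriv_gauss_moment m y :
  has_deriv (gauss_moment m) y (- gauss_moment m.+1 y).
Proof.
(* Dominates the y-derivative of the integrand for all parameters z in ]y - 1, y + 1[, which may be
   negative, and all v in [0, 1]: there - z v^2 <= |y| + 1. *)
pose M := expR (`|y| + 1).
have K : h^-1 *: (gauss_moment m (h + y) - gauss_moment m y) @[h --> 0^'] -->
    \int[mu]_(v in `[0, 1])
      (partial1of2 (fun y v => v ^+ m.*2 * expR (- (y * v ^+ 2))) y v).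
  apply: (@cvg_differentiation_under_integral _ _ _ mu _ _ _ y (y - 1) (y + 1)
    _ _ _ (cst M)) => //.
  - by rewrite /= in_itv/=; apply/andP; split; lra.
  - by move=> z _; exact: integrable_gauss_integrand.
  - by move=> v; rewrite /M /= expR_ge0.
  - apply: continuous_compact_integrable; first exact: segment_compact.
    by apply: continuous_subspaceT => ?; exact: cst_continuous.
  - move=> z v /=; rewrite !in_itv/= => /andP[z1 z2] /andP[v0 v1].
    rewrite partial1of2E (has_deriv_derive (has_deriv_gauss_integrand m z v)).
    have p0 : 0 <= v ^+ m.+1.*2 by exact: exprn_ge0.
    rewrite normrN ger0_norm; last by rewrite mulr_ge0 ?expR_ge0.
    apply: (@le_trans _ _ (1 * M)); last by rewrite mul1r.
    rewrite ler_pM ?expR_ge0//; first exact: exprn_ile1.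
    rewrite ler_expR.
    have v21 : v ^+ 2 <= 1 by rewrite exprn_ile1.
    have v20 : 0 <= v ^+ 2 by rewrite sqr_ge0.
    have := ler_norm (- y); rewrite normrN => yy.
    have [z0|z0] := leP 0 z.
      have : 0 <= z * v ^+ 2 by rewrite mulr_ge0.
      by have := normr_ge0 y; lra.
    by nra.
have E : (fun h => h^-1 *: ((gauss_moment m \o shift y) (h *: 1) - gauss_moment m y)) =
    (fun h => h^-1 *: (gauss_moment m (h + y) - gauss_moment m y)).
  by apply/funext => h; rewrite /= [h *: 1]mulr1.
apply: (@has_deriv_eq _ _ _ (\int[mu]_(v in `[0, 1])
      (partial1of2 (fun y v => v ^+ m.*2 * expR (- (y * v ^+ 2))) y v))).
  split; first by rewrite /derivable E; apply/cvg_ex; eexists; exact: K.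
  by rewrite /derive E; exact: cvg_lim K.
rewrite -[RHS]mulN1r -RintegralZl; [|by []|exact: integrable_gauss_integrand].
apply: eq_Rintegral => v _.
by rewrite partial1of2E (has_deriv_derive (has_deriv_gauss_integrand m y v)) mulN1r.
Qed.

(** Integrate the derivative of v^(2m+1) exp(- y v^2), given by [has_deriv_gauss_power], over
    [0, 1]. *)
Lemma gauss_moment_rec m y :
  m.*2.+1%:R * gauss_moment m y = 2 * y * gauss_moment m.+1 y + expR (- y).
Proof.
pose I k := fun v => v ^+ k.*2 * expR (- (y * v ^+ 2)).
have iI k : mu.-integrable `[0, 1] (EFin \o I k).
  exact: integrable_gauss_integrand.
have iZ c k : mu.-integrable `[0, 1] (EFin \o (fun v => c * I k v)).
  exact: (@integrableZl _ _ _ mu _ (measurable_itv `[0, 1]) c _ (iI k)).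
have Z c k : c * gauss_moment k y = \int[mu]_(v in `[0, 1]) (c * I k v).
  by rewrite RintegralZl.
apply/eqP; rewrite addrC -subr_eq; apply/eqP.
rewrite !Z -RintegralB//.
have c (f : R -> R) (df : R -> R) : (forall v, has_deriv f v (df v)) ->
    derivable_oo_LRcontinuous f 0 1.
  move=> d; split => [v _|//|]; first by have [] := d v.
    by apply: cvg_at_right_filter; exact: has_deriv_continuous.
  by apply: cvg_at_left_filter; exact: has_deriv_continuous.
rewrite /Rintegral (@continuous_FTC2 _ _ (fun v => v ^+ m.*2.+1 * expR (- (y * v ^+ 2)))) //.
- by rewrite !expr1n expr0n/= mul1r mulr1 mul0r subr0.
- apply: continuous_subspaceT => v.
  apply: (@continuousB _ _ _ (fun v => m.*2.+1%:R * I m v) (fun v => 2 * y * I m.+1 v));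
    apply: cvgM; try exact: continuous_gauss_integrand; exact: cvg_cst.
- exact/c/has_deriv_gauss_power.
- by move=> v _; exact/has_deriv_derive1/has_deriv_gauss_power.
Qed.

(** The function is the integral of exp(- q s^2) over [0, w], rescaled to [0, 1]; the recursion at m
    = 0 cancels all but the exponential. *)
Lemma has_deriv_gauss_primitive (q w : R) :
  has_deriv (fun w => w * gauss_moment 0 (q * w ^+ 2)) w (expR (- (q * w ^+ 2))).
Proof.
apply: has_deriv_eq.
  apply: has_derivM (has_deriv_id _) _.
  apply: has_deriv_comp (has_deriv_gauss_moment _ _) _.
  exact: has_derivM (has_deriv_cst _ _) (has_derivX _ (has_deriv_id _)).
have := gauss_moment_rec 0 (q * w ^+ 2); rewrite mul1r => ->/=.
by rewrite expr1; ring.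
Qed.

(** Follows from exp(- v^2) <= 1 / (1 + v^2), and bounds the primitive of the Gaussian uniformly in
    w. *)
Lemma gauss_primitive_le_atan (w : R) : 0 <= w -> w * gauss_moment 0 (w ^+ 2) <= atan w.
Proof.
move=> w0; pose f w := atan w - w * gauss_moment 0 (1 * w ^+ 2) : R.
have df v : has_deriv f v ((1 + v ^+ 2)^-1 - expR (- (1 * v ^+ 2))).
  exact: has_derivD (has_deriv_atan v) (has_derivN (has_deriv_gauss_primitive 1 v)).
suff : f 0 <= f w by rewrite /f atan0 mul0r !subr0 mul1r subr_ge0.
apply: (@ger0_derive1_le_cc _ f 0 w); last 3 first.
- by rewrite in_itv/= lexx w0.
- by rewrite in_itv/= w0 lexx.
- exact: w0.
- by move=> v _; have [] := df v.
- move=> v _; rewrite (has_deriv_derive1 (df v)) subr_ge0 mul1r expRN.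
  rewrite lef_pV2 ?posrE ?expR_gt0//; last by rewrite ltr_wpDr ?sqr_ge0.
  exact: expR_ge1Dx.
- by apply: continuous_subspaceT => v; exact: has_deriv_continuous (df v).
Qed.

(** In the induction step the recursion gives 2 y g_(m+1) <= (2m + 1) g_m; together with g_(m+1) <=
    g_m this yields (1 + y) g_(m+1) <= (m + 2) g_m, which trades two powers of the square root for
    one index. *)
Lemma gauss_moment_bound m : exists2 C : R, 0 <= C &
  forall y, 0 <= y -> gauss_moment m y * Num.sqrt (1 + y) ^+ m.*2.+1 <= C.
Proof.
elim: m => [|m [C C0 IH]].
  (* 3 = 1 + 2: the moment is at most 1, sqrt y times it is at most pi / 2 < 2, and sqrt (1 + y) <=
     1 + sqrt y. *)
  exists 3 => // y y0; rewrite expr1.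
  have s0 := sqrtr_ge0 y; have ss := sqr_sqrtr y0.
  have g1 := gauss_moment0_le1 _ y0; have g0 := gauss_moment_ge0 0 y.
  have sg : Num.sqrt y * gauss_moment 0 y <= 2.
    have := gauss_primitive_le_atan _ s0; rewrite ss => /le_trans; apply.
    exact: ltW (lt_trans (atan_ltpi2 _) (pihalf_lt2 _)).
  apply: (@le_trans _ _ (gauss_moment 0 y * (1 + Num.sqrt y))); last by nra.
  rewrite ler_wpM2l// -(@ler_pXn2r _ 2)// ?nnegrE ?sqrtr_ge0 ?addr_ge0//.
  by rewrite sqr_sqrtr ?addr_ge0//; nra.
exists (m.+2%:R * C) => [|y y0]; first by rewrite mulr_ge0.
have y1 : 0 <= 1 + y by rewrite addr_ge0.
rewrite doubleS exprS exprS 2!mulrA -(mulrA (gauss_moment _ _)) -expr2 sqr_sqrtr//.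
apply: le_trans (ler_wpM2l (ler0n _ m.+2) (IH y y0)).
rewrite !mulrA ler_wpM2r ?exprn_ge0 ?sqrtr_ge0//.
have := gauss_moment_rec m y; have := gauss_momentS_le m y; have := expR_ge0 (-y).
have := gauss_moment_ge0 m y.
have -> : m.*2.+1%:R = 2 * m%:R + 1 :> R by rewrite -addn1 natrD -mul2n natrM.
by rewrite -addn2 natrD => *; nra.
Qed.

End GaussianMoments.

(** * The Newtonian potential of the heat kernel *)

Section NewtonHeat.
Context {R : realType}.
Local Notation mu := (@lebesgue_measure R).
Implicit Types (b c t u y : R).

Lemma integralT_scale (f : R -> R) (k : R) :
  measurable_fun [set: measurableTypeR R] f -> (forall y, 0 <= f y) -> 0 <= k ->
  (\int[mu]_y (k * f y)%:E = k%:E * \int[mu]_y (f y)%:E)%E.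
Proof.
move=> mf f0 k0; under eq_integral do rewrite EFinM.
apply: ge0_integralZl => //; first exact/measurable_EFinP.
by move=> y _; rewrite lee_fin.
Qed.

Lemma integral_gaussian b c : 0 < b ->
  (\int[mu]_y (expR (- (b * (y - c) ^+ 2)))%:E = (Num.sqrt (pi / b))%:E)%E.
Proof.
move=> b0; have pb0 : 0 < Num.sqrt (pi / b) by rewrite sqrtr_gt0 divr_gt0 ?pi_gt0.
(* The standard deviation for which the normal density is proportional to the integrand. *)
pose s : R := Num.sqrt (2 * b)^-1.
have s2 : s ^+ 2 = (2 * b)^-1 by rewrite sqr_sqrtr// invr_ge0 mulr_ge0// ltW.
have s0 : s != 0 by rewrite gt_eqF// sqrtr_gt0 invr_gt0 mulr_gt0.
have b1 : b != 0 by rewrite gt_eqF.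
have E y : expR (- (b * (y - c) ^+ 2)) = Num.sqrt (pi / b) * normal_pdf c s y.
  rewrite normal_pdfE// /normal_peak /normal_fun s2.
  have -> : (2 * b)^-1 * pi *+ 2 = pi / b :> R by field.
  rewrite [RHS]mulrA divff ?gt_eqF// mul1r; congr expR.
  by rewrite mulr2n; field.
under eq_integral do rewrite E.
rewrite integralT_scale ?integral_normal_pdf ?mule1 ?ltW//.
- exact: measurable_normal_pdf.
- by move=> y; exact: normal_pdf_ge0.
Qed.

Definition heat1 t y : R := (Num.sqrt (4 * pi * t))^-1 * expR (- (y ^+ 2 / (4 * t))).

(** The convolution of exp(- u^2 y^2) with the one-dimensional heat kernel at time t, in closed
    form. *)
Definition gauss_conv t u z : R := (Num.sqrt (1 + 4 * t * u ^+ 2))^-1 *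
  expR (- (z ^+ 2 * (u ^+ 2 / (1 + 4 * t * u ^+ 2)))).

Lemma gauss_conv_denom_gt0 t u : 0 < t -> 0 < 1 + 4 * t * u ^+ 2.
Proof. by move=> t0; rewrite ltr_pwDl// mulr_ge0 ?sqr_ge0// mulr_ge0// ltW. Qed.

Lemma heat1_ge0 t y : 0 <= heat1 t y.
Proof. by rewrite mulr_ge0 ?expR_ge0 ?invr_ge0 ?sqrtr_ge0. Qed.

Lemma gauss_conv_ge0 t u z : 0 <= gauss_conv t u z.
Proof. by rewrite mulr_ge0 ?expR_ge0 ?invr_ge0 ?sqrtr_ge0. Qed.

Lemma integral_gauss_heat1 t u z : 0 < t ->
  (\int[mu]_y (expR (- (u ^+ 2 * (z - y) ^+ 2)) * heat1 t y)%:E =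
  (gauss_conv t u z)%:E)%E.
Proof.
move=> t0; have D := gauss_conv_denom_gt0 t u t0; have tn : t != 0 by rewrite gt_eqF.
have pi0 : 0 < pi :> R := pi_gt0 R.
have Dn : 1 + 4 * t * u ^+ 2 != 0 by rewrite gt_eqF.
have pin : pi != 0 :> R by rewrite gt_eqF.
(* Completing the square in y: the exponents add up to - b (y - u^2 z / b)^2 and a term free of y,
   which goes into [C]. *)
pose b : R := u ^+ 2 + (4 * t)^-1.
have bE : b = (1 + 4 * t * u ^+ 2) / (4 * t) by rewrite /b; field.
have b0 : 0 < b by rewrite bE divr_gt0// mulr_gt0.
pose C := (Num.sqrt (4 * pi * t))^-1 * expR (- (z ^+ 2 * (u ^+ 2 / (1 + 4 * t * u ^+ 2)))).
have C0 : 0 <= C by rewrite mulr_ge0 ?expR_ge0 ?invr_ge0 ?sqrtr_ge0.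
have E y : expR (- (u ^+ 2 * (z - y) ^+ 2)) * heat1 t y =
    C * expR (- (b * (y - u ^+ 2 * z / b) ^+ 2)).
  rewrite /heat1 mulrCA /C -!mulrA -!expRD; congr (_ * expR _); rewrite bE.
  by field; rewrite ?tn ?Dn.
under eq_integral do rewrite E.
rewrite integralT_scale//; last first.
  apply: continuous_measurable_fun => y.
  apply: has_deriv_continuous; apply: has_deriv_comp (has_deriv_expR _) _.
  apply: has_derivN; apply: has_derivM (has_deriv_cst _ _) _.
  exact: has_derivX _ (has_derivD (has_deriv_id _) (has_deriv_cst _ _)).
rewrite integral_gaussian// -EFinM /C /gauss_conv mulrAC; congr (_ * _)%:E.
rewrite bE -sqrtrV ?mulr_ge0 ?(ltW t0) ?(ltW pi0)// -sqrtrM; last first.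
  by rewrite invr_ge0 !mulr_ge0 ?(ltW t0) ?(ltW pi0).
rewrite -sqrtrV ?(ltW D)//; congr Num.sqrt.
by move: (pi : R) pin => p pn; field; rewrite tn pn Dn.
Qed.

Lemma continuous_gauss_conv t z : 0 < t -> continuous (gauss_conv t ^~ z).
Proof.
move=> t0 u; have D := gauss_conv_denom_gt0 t u t0.
have D0 : 1 + 4 * t * u ^+ 2 != 0 by rewrite gt_eqF.
have cD : {for u, continuous (fun u => 1 + 4 * t * u ^+ 2)}.
  apply: has_deriv_continuous; apply: has_derivD (has_deriv_cst _ _) _.
  exact: has_derivM (has_deriv_cst _ _) (has_derivX _ (has_deriv_id _)).
apply: cvgM.
  apply: cvgV; first by rewrite gt_eqF// sqrtr_gt0.
  exact: continuous_comp cD (@sqrt_continuous _ _).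
apply: continuous_comp; last exact: continuous_expR.
apply: cvgN; apply: cvgM; first exact: cvg_cst.
by apply: cvgM; [exact: exprn_continuous|exact: cvgV].
Qed.

(** Integrates out one coordinate y under the u-integral, replacing the only factor that depends on
    it by its integral; applied once for each coordinate. *)
Lemma tonelli_factor (A C : R -> R) (B : R -> R -> R) :
  (forall u, 0 <= A u) -> (forall u y, 0 <= B u y) ->
  measurable_fun setT A ->
  measurable_fun setT (fun p : measurableTypeR R * measurableTypeR R => B p.2 p.1) ->
  (forall u, \int[mu]_y (B u y)%:E = (C u)%:E)%E ->
  (\int[mu]_y \int[mu]_u (A u * B u y)%:E = \int[mu]_u (A u * C u)%:E)%E.
Proof.
move=> A0 B0 mA mB BC.
pose f (p : measurableTypeR R * measurableTypeR R) := (A p.2 * B p.2 p.1)%:E.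
have mf : measurable_fun setT f.
  apply/measurable_EFinP; apply: measurable_funM => //.
  by apply: measurableT_comp => //; exact: measurable_snd.
rewrite (fubini_tonelli (m1 := mu) (m2 := mu) f)//; last first.
  by move=> p; rewrite lee_fin mulr_ge0.
apply: eq_integral => u _; rewrite /f/=.
rewrite integralT_scale//; first by rewrite BC EFinM.
exact: (measurableT_comp mB (measurable_pair2 u)).
Qed.

End NewtonHeat.

(* The library declares products of probability measures as the canonical
   sigma-finite products, which hides the instance for general products. *)
Section PlaneMeasure.
Context {R : realType}.
Local Notation mu := (@lebesgue_measure R).

Definition lebesgue2 : set (measurableTypeR R * measurableTypeR R) -> \bar R :=
  (mu \x mu)%E.

HB.instance Definition _ := Measure.copy lebesgue2 (mu \x mu)%E.

Lemma sigma_finite_lebesgue2 : sigma_finite setT lebesgue2.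
Proof.
have /sigma_finiteP[F [TF ndF Foo]] := sigma_finiteT mu.
exists (fun n => F n `*` F n) => [|n].
  apply/seteqP; split => // -[x y] _.
  have [i _ Fx] : (\bigcup_n F n) x by rewrite -TF.
  have [j _ Fy] : (\bigcup_n F n) y by rewrite -TF.
  exists (maxn i j) => //; split => /=.
    by move: x Fx; exact/subsetPset/ndF/leq_maxl.
  by move: y Fy; exact/subsetPset/ndF/leq_maxr.
have [mF Fn] := Foo n; split; first exact: measurableX.
by rewrite /lebesgue2 product_measure1E// lte_mul_pinfty// ge0_fin_numE.
Qed.

HB.instance Definition _ :=
  Measure_isSigmaFinite.Build _ _ _ lebesgue2 sigma_finite_lebesgue2.

End PlaneMeasure.

(** * The potential as a one-dimensional integral *)

Section NewtonHeat3.
Context {R : realType}.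
Local Notation mu := (@lebesgue_measure R).
Implicit Types (a b c t u : R) (z : 'cV[R]_3).

Definition sqnorm z : R := \sum_(i < 3) z i 0 ^+ 2.

Lemma sqnormE z : sqnorm z = z 0 0 ^+ 2 + z 1 0 ^+ 2 + z 2 0 ^+ 2.
Proof.
rewrite /sqnorm !big_ord_recl big_ord0 addr0 addrA.
by congr (z _ 0 ^+ 2 + z _ 0 ^+ 2 + z _ 0 ^+ 2); apply: val_inj.
Qed.

Lemma sqnorm_ge0 z : 0 <= sqnorm z.
Proof. by apply: sumr_ge0 => i _; exact: sqr_ge0. Qed.

Lemma enorm_sqr z : enorm z ^+ 2 = sqnorm z.
Proof. exact/sqr_sqrtr/sqnorm_ge0. Qed.

Lemma vec3E a b c :
  ((vec3 a b c) 0 0 = a) * ((vec3 a b c) 1 0 = b) * ((vec3 a b c) 2 0 = c).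
Proof. by rewrite /vec3 !mxE. Qed.

Lemma powR_N32 a : 0 < a -> a `^ (- (3 / 2)) = (Num.sqrt a)^-1 ^+ 3.
Proof.
move=> a0; rewrite powRN exprVn; congr _^-1.
by rewrite mulrC powRrM powR12_sqrt ?ltW// powR_mulrn ?sqrtr_ge0.
Qed.

Lemma heat_vec3 a b c t : 0 < t ->
  heat (vec3 a b c) t = heat1 t a * heat1 t b * heat1 t c.
Proof.
move=> t0; rewrite /heat enorm_sqr sqnormE !vec3E powR_N32; last first.
  by rewrite !mulr_gt0 ?pi_gt0.
rewrite /heat1 !mulrDl !opprD !expRD; ring.
Qed.

(** The integral of exp(- |z|^2 u^2) over the line is sqrt pi / |z|; this factor turns it into 1 /
    (4 pi |z|). *)
Definition newton_cst : R := (4 * pi * Num.sqrt pi)^-1.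

Lemma newton_cst_ge0 : 0 <= newton_cst.
Proof. by rewrite invr_ge0 !mulr_ge0 ?pi_ge0 ?sqrtr_ge0. Qed.

Lemma newton_powR z : newton z = (4 * pi)^-1 * sqnorm z `^ (- 2^-1).
Proof.
by rewrite /newton /enorm invfM powRN powR12_sqrt// sqnorm_ge0.
Qed.

Lemma measurable_gauss a : measurable_fun [set: measurableTypeR R]
  (fun u => expR (- (a * u ^+ 2))).
Proof.
apply: continuous_measurable_fun => u.
apply: has_deriv_continuous; apply: has_deriv_comp (has_deriv_expR _) _.
apply: has_derivN; apply: has_derivM (has_deriv_cst _ _) _.
exact: has_derivX _ (has_deriv_id _).
Qed.

Lemma newton_gaussian z : 0 < sqnorm z ->
  (\int[mu]_u (newton_cst * expR (- (sqnorm z * u ^+ 2)))%:E = (newton z)%:E)%E.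
Proof.
move=> z0; rewrite integralT_scale//; last 2 first.
- exact: measurable_gauss.
- exact: newton_cst_ge0.
have := integral_gaussian (sqnorm z) 0 z0.
under eq_integral do rewrite subr0.
move=> ->; rewrite -EFinM /newton /newton_cst /enorm; congr (_%:E).
rewrite sqrtrM ?pi_ge0// sqrtrV ?ltW//.
have p0 : pi != 0 :> R by rewrite gt_eqF ?pi_gt0.
have s0 : Num.sqrt pi != 0 :> R by rewrite gt_eqF ?sqrtr_gt0 ?pi_gt0.
have sz : Num.sqrt (sqnorm z) != 0 by rewrite gt_eqF ?sqrtr_gt0.
by move: (pi : R) p0 (Num.sqrt _) s0 => p p0 s s0; field; rewrite ?p0 ?s0 ?sz.
Qed.

Definition gauss_heat z t (i : 'I_3) u y : R :=
  expR (- (u ^+ 2 * (z i 0 - y) ^+ 2)) * heat1 t y.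

Lemma gauss_heat_ge0 z t i u y : 0 <= gauss_heat z t i u y.
Proof. by rewrite mulr_ge0 ?expR_ge0// heat1_ge0. Qed.

Lemma measurable_heat1 t : measurable_fun setT (heat1 t).
Proof.
apply: measurable_funM => //; apply: measurableT_comp => //.
by apply: measurableT_comp => //; apply: measurable_funM.
Qed.

Lemma measurable_gauss_heat d (T : measurableType d) z t i (f g : T -> R) :
  measurable_fun setT f -> measurable_fun setT g ->
  measurable_fun setT (fun p => gauss_heat z t i (f p) (g p)).
Proof.
move=> mf mg; apply: measurable_funM; last exact: measurableT_comp (measurable_heat1 t) mg.
apply: measurableT_comp => //; apply: measurableT_comp => //; apply: measurable_funM.
  exact: measurable_funX.
by apply: measurable_funX; exact: measurable_funB.
Qed.

(** The Gaussian representation of [newton] fails at the singularity. Excluding the whole plane y_1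
    = z_1 keeps the exception a null set in the single variable that is integrated last. *)
Lemma newton_heat_gaussian z t a b c : 0 < t -> a != z 0 0 ->
  ((newton (z - vec3 a b c) * heat (vec3 a b c) t)%:E =
   \int[mu]_u (newton_cst * gauss_heat z t 0 u a * gauss_heat z t 1 u b *
     gauss_heat z t 2 u c)%:E)%E.
Proof.
move=> t0 az; have p0 : 0 < sqnorm (z - vec3 a b c).
  rewrite sqnormE !mxE/= -addrA ltr_pwDl ?addr_ge0 ?sqr_ge0//.
  by rewrite exprn_even_gt0//= subr_eq0 eq_sym.
rewrite EFinM muleC -newton_gaussian//.
rewrite -integralT_scale; last 3 first.
- by apply: measurable_funM => //; exact: measurable_gauss.
- by move=> u; rewrite mulr_ge0 ?expR_ge0 ?newton_cst_ge0.
- by rewrite heat_vec3// !mulr_ge0// heat1_ge0.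
apply: eq_integral => u _; congr (_%:E).
rewrite heat_vec3// sqnormE !mxE/= /gauss_heat.
by rewrite !mulrDl !opprD !expRD ![_ * u ^+ 2]mulrC; ring.
Qed.

Lemma measurable_newton_heat z t : 0 < t ->
  measurable_fun [set: (measurableTypeR R * measurableTypeR R) * measurableTypeR R]
   (fun y => newton (z - vec3 y.1.1 y.1.2 y.2) * heat (vec3 y.1.1 y.1.2 y.2) t).
Proof.
move=> t0; have m11 : measurable_fun setT
    (fun y : (measurableTypeR R * measurableTypeR R) * measurableTypeR R => y.1.1).
  exact: measurableT_comp.
have m12 : measurable_fun setT
    (fun y : (measurableTypeR R * measurableTypeR R) * measurableTypeR R => y.1.2).
  exact: measurableT_comp.
have m2 : measurable_fun setT
    (fun y : (measurableTypeR R * measurableTypeR R) * measurableTypeR R => y.2).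
  exact: measurable_snd.
apply: measurable_funM.
  rewrite (_ : (fun _ => _) = fun y => (4 * pi)^-1 * ((z 0 0 - y.1.1) ^+ 2 +
      (z 1 0 - y.1.2) ^+ 2 + (z 2 0 - y.2) ^+ 2) `^ (- 2^-1)); last first.
    by apply/funext => y; rewrite newton_powR sqnormE !mxE.
  apply: measurable_funM => //; apply: (measurableT_comp (measurable_powR (- 2^-1))).
  by apply: measurable_funD; [apply: measurable_funD|];
    apply: measurable_funX; exact: measurable_funB.
rewrite (_ : (fun _ => _) = fun y => heat1 t y.1.1 * heat1 t y.1.2 * heat1 t y.2);
  last by apply/funext => y; rewrite heat_vec3.
by apply: measurable_funM; [apply: measurable_funM|];
  exact: measurableT_comp (measurable_heat1 t) _.
Qed.

(** For fixed u the integrand is a product over the coordinates, so each y-integral is a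
    one-dimensional Gaussian convolution. Everything is nonnegative, and Tonelli moves the
    y-integrals inside one at a time, from the third coordinate to the first. *)
Lemma integral_newton_heat z t : 0 < t ->
  (\int[@lebesgue3 R]_y
     (newton (z - vec3 y.1.1 y.1.2 y.2) * heat (vec3 y.1.1 y.1.2 y.2) t)%:E =
  \int[mu]_u (newton_cst * gauss_conv t u (z 0 0) * gauss_conv t u (z 1 0) *
    gauss_conv t u (z 2 0))%:E)%E.
Proof.
move=> t0; have m := measurable_newton_heat z t t0.
pose f (y : (measurableTypeR R * measurableTypeR R) * measurableTypeR R) : \bar R :=
  (newton (z - vec3 y.1.1 y.1.2 y.2) * heat (vec3 y.1.1 y.1.2 y.2) t)%:E.
have mf : measurable_fun setT f by exact/measurable_EFinP.
have f0 y : (0 <= f y)%E.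
  rewrite lee_fin mulr_ge0//; first by rewrite invr_ge0 !mulr_ge0 ?pi_ge0 ?sqrtr_ge0.
  by rewrite mulr_ge0 ?powR_ge0 ?expR_ge0.
apply: etrans (fubini_tonelli1 (m1 := @lebesgue2 R) (m2 := mu) f mf f0) _.
have mF := measurable_fun_fubini_tonelli_F (m2 := mu) f mf f0.
have F0 y : (0 <= fubini_F mu f y)%E by apply: integral_ge0.
apply: etrans (fubini_tonelli1 (m1 := mu) (m2 := mu) _ mF F0) _.
have mc i := continuous_measurable_fun (continuous_gauss_conv t (z i 0) t0).
have c0 := gauss_conv_ge0; have g0 := gauss_heat_ge0; have n0 := newton_cst_ge0.
pose G (y : R) := (\int[mu]_u (newton_cst * gauss_conv t u (z 1 0) *
    gauss_conv t u (z 2 0) * gauss_heat z t 0 u y)%:E)%E.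
transitivity (\int[mu]_y G y)%E.
  have mG : measurable_fun setT G.
    apply: (@measurable_fun_fubini_tonelli_F _ _ (measurableTypeR R) (measurableTypeR R) _ mu
      (fun p => (newton_cst * gauss_conv t p.2 (z 1 0) *
    gauss_conv t p.2 (z 2 0) * gauss_heat z t 0 p.2 p.1)%:E)).
      apply/measurable_EFinP; apply: measurable_funM; last exact: measurable_gauss_heat.
      apply: measurable_funM; first apply: measurable_funM => //.
        exact: measurableT_comp (mc 1) _.
      exact: measurableT_comp (mc 2) _.
    by move=> p; rewrite lee_fin !mulr_ge0.
  apply: ge0_ae_eq_integral => //.
  - exact: measurable_fun_fubini_tonelli_F.
  - by move=> y _; apply: integral_ge0.
  - by move=> y _; apply: integral_ge0 => u _; rewrite lee_fin !mulr_ge0.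
  exists [set z 0 0]; split => //; first exact: lebesgue_measure_set1.
  move=> y /= yz; apply: contrapT => /eqP ynz; apply: yz => _.
  rewrite /fubini_F /f/=.
  transitivity (\int[mu]_b \int[mu]_u (newton_cst * gauss_heat z t 0 u y *
      gauss_conv t u (z 2 0) * gauss_heat z t 1 u b)%:E)%E.
    apply: eq_integral => b _.
    under eq_integral do rewrite newton_heat_gaussian//.
    rewrite (tonelli_factor _ (fun u => gauss_conv t u (z 2 0))).
    - by apply: eq_integral => u _; congr _%:E; ring.
    - by move=> u; rewrite !mulr_ge0.
    - by move=> u c; exact: g0.
    - by apply: measurable_funM; [apply: measurable_funM => //|]; exact: measurable_gauss_heat.
    - exact: measurable_gauss_heat.
    - by move=> u; exact: integral_gauss_heat1.
  rewrite (tonelli_factor _ (fun u => gauss_conv t u (z 1 0))).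
  - by apply: eq_integral => u _; congr _%:E; ring.
  - by move=> u; rewrite !mulr_ge0.
  - by move=> u c; exact: g0.
  - apply: measurable_funM; last exact: mc.
    by apply: measurable_funM => //; exact: measurable_gauss_heat.
  - exact: measurable_gauss_heat.
  - by move=> u; exact: integral_gauss_heat1.
rewrite (tonelli_factor _ (fun u => gauss_conv t u (z 0 0))).
- by apply: eq_integral => u _; congr _%:E; ring.
- by move=> u; rewrite !mulr_ge0.
- by move=> u c; exact: g0.
- by apply: measurable_funM; [apply: measurable_funM => //|]; exact: mc.
- exact: measurable_gauss_heat.
- by move=> u; exact: integral_gauss_heat1.
Qed.

End NewtonHeat3.

(** * Closed form of the potential *)

Section NewtonPotential.
Context {R : realType}.
Local Notation mu := (@lebesgue_measure R).
Implicit Types (a b c t u q : R) (z : 'cV[R]_3).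

(* The substitution w = u / sqrt (1 + 4 t u^2) turns the u-integral into the
   integral of exp (- q w^2) over [0, 1 / sqrt (4 t)]. *)
Definition gauss_subst t u : R := u * (Num.sqrt (1 + 4 * t * u ^+ 2))^-1.

(** The cube equals the product of the three prefactors of [gauss_conv]: in dimension three the
    Jacobian of the substitution absorbs them exactly. *)
Lemma has_deriv_gauss_subst t u : 0 < t ->
  has_deriv (gauss_subst t) u ((Num.sqrt (1 + 4 * t * u ^+ 2))^-1 ^+ 3).
Proof.
move=> t0; have D := gauss_conv_denom_gt0 t u t0.
have s0 : 0 < Num.sqrt (1 + 4 * t * u ^+ 2) by rewrite sqrtr_gt0.
have ss : Num.sqrt (1 + 4 * t * u ^+ 2) ^+ 2 = 1 + 4 * t * u ^+ 2.
  by rewrite sqr_sqrtr// ltW.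
have dD : has_deriv (fun u => 1 + 4 * t * u ^+ 2) u (8 * t * u).
  apply: has_deriv_eq.
    apply: has_derivD (has_deriv_cst _ _) _.
    exact: has_derivM (has_deriv_cst _ _) (has_derivX _ (has_deriv_id _)).
  by rewrite /= expr1; ring.
have dV := has_derivV (has_deriv_sqrt dD D) (lt0r_neq0 s0).
apply: has_deriv_eq (has_derivM (has_deriv_id u) dV) _.
move: ss s0; set s := Num.sqrt _ => ss s0.
have -> : (2 * s)^-1 * (8 * t * u) = (4 * t * u) / s.
  by field; rewrite gt_eqF.
have E : 4 * t * u ^+ 2 = s ^+ 2 - 1 by rewrite ss; ring.
transitivity (s^-1 - (4 * t * u ^+ 2) / s ^+ 3).
  by rewrite /GRing.scale/=; field; rewrite gt_eqF.
by rewrite E; field; rewrite gt_eqF.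
Qed.

Lemma cvg_gauss_subst t : 0 < t ->
  gauss_subst t u @[u --> +oo] --> (Num.sqrt (4 * t))^-1.
Proof.
move=> t0.
have V0 : u^-1 @[u --> +oo] --> (0 : R).
  apply/(gtr0_cvgV0 (f := id)); last exact: cvg_id.
  by near=> u; near: u; exact: nbhs_pinfty_gt.
have : (Num.sqrt (u^-1 ^+ 2 + 4 * t))^-1 @[u --> +oo] --> (Num.sqrt (0 ^+ 2 + 4 * t))^-1.
  have t4 : 0 < 0 ^+ 2 + 4 * t by rewrite expr0n/= add0r mulr_gt0.
  apply: cvgV; first by rewrite gt_eqF// sqrtr_gt0.
  apply: continuous_cvg; first exact: sqrt_continuous.
  apply: cvgD; last exact: cvg_cst.
  apply: (@continuous_cvg _ _ _ _ _ _ (fun v : R => v ^+ 2)); first exact: exprn_continuous.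
  exact: V0.
rewrite expr0n/= add0r; apply: cvg_trans; apply: near_eq_cvg.
near=> u; have u0 : 0 < u by near: u; exact: nbhs_pinfty_gt.
symmetry; rewrite /gauss_subst -[X in X * _ = _]invrK -invfM; congr _^-1.
have u1 : 0 <= u^-1 by rewrite invr_ge0 ltW.
rewrite -[X in X * _ = _](ger0_norm u1) -sqrtr_sqr -sqrtrM ?sqr_ge0//.
by congr Num.sqrt; field; rewrite gt_eqF.
Unshelve. all: by end_near. Qed.

Lemma integral_gauss_subst t q : 0 < t -> 0 <= q ->
  (\int[mu]_u ((Num.sqrt (1 + 4 * t * u ^+ 2))^-1 ^+ 3 *
     expR (- (q * gauss_subst t u ^+ 2)))%:E =
   (2 * ((Num.sqrt (4 * t))^-1 * gauss_moment 0 (q / (4 * t))))%:E)%E.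
Proof.
move=> t0 q0; pose f u := (Num.sqrt (1 + 4 * t * u ^+ 2))^-1 ^+ 3 *
  expR (- (q * gauss_subst t u ^+ 2)).
rewrite -[LHS]/(\int[mu]_u (f u)%:E)%E.
pose F u := gauss_subst t u * gauss_moment 0 (q * gauss_subst t u ^+ 2).
have dF u : has_deriv F u (f u).
  apply: has_deriv_eq.
    exact: (has_deriv_comp (has_deriv_gauss_primitive q _) (has_deriv_gauss_subst t u t0)).
  by rewrite /f mulrC.
have cf : continuous f.
  move=> u; have D := gauss_conv_denom_gt0 t u t0.
  apply: cvgM.
    apply: (continuous_comp (f := fun u => (Num.sqrt (1 + 4 * t * u ^+ 2))^-1)
       (g := fun x : R => x ^+ 3)); last exact: exprn_continuous.
    apply: cvgV; first by rewrite gt_eqF// sqrtr_gt0.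
    apply: (continuous_comp (f := fun u => 1 + 4 * t * u ^+ 2)
       (g := Num.sqrt)); last exact: sqrt_continuous.
    apply: (@has_deriv_continuous _ _ u); apply: has_derivD (has_deriv_cst _ _) _.
    exact: has_derivM (has_deriv_cst _ _) (has_derivX _ (has_deriv_id _)).
  apply: (@has_deriv_continuous _ _ u); apply: has_deriv_comp (has_deriv_expR _) _.
  apply: has_derivN; apply: has_derivM (has_deriv_cst _ _) _.
  exact: has_derivX _ (has_deriv_gauss_subst t u t0).
have f0 u : 0 <= f u by rewrite mulr_ge0 ?expR_ge0 ?exprn_ge0 ?invr_ge0 ?sqrtr_ge0.
(* The integrand is even in u; this is the origin of the factor 2, and [F] is a primitive on the
   half line. *)
rewrite ge0_symfun_integralT//; last first.
  by move=> u; rewrite /f /gauss_subst /= sqrrN mulNr sqrrN.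
rewrite EFinM; congr (_ * _)%E.
rewrite (_ : [set x | _] = `[0%R, +oo[%classic); last first.
  by apply/seteqP; split => x /=; rewrite in_itv/= andbT.
rewrite (ge0_continuous_FTC2y (F := F)
  (l := (Num.sqrt (4 * t))^-1 * gauss_moment 0 (q / (4 * t)))).
- by rewrite /F /gauss_subst !mul0r sube0.
- by move=> x _; exact: f0.
- exact: continuous_subspaceT.
- have -> : q / (4 * t) = q * (Num.sqrt (4 * t))^-1 ^+ 2.
    by rewrite exprVn sqr_sqrtr// mulr_ge0// ltW.
  apply: (@cvg_comp _ _ _ (gauss_subst t) (fun w => w * gauss_moment 0 (q * w ^+ 2))
    _ _ _ (cvg_gauss_subst t t0)).
  exact: has_deriv_continuous (has_deriv_gauss_primitive q _).
- by move=> x _; exact: has_deriv_derivable (dF x).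
- apply: cvg_at_right_filter; exact: has_deriv_continuous (dF 0).
- by move=> x _; exact: has_deriv_derive1 (dF x).
Qed.

Lemma newton_heat_potential z t : 0 < t ->
  integral3 (fun y => newton (z - y) * heat y t) =
  2 * newton_cst * ((Num.sqrt (4 * t))^-1 * gauss_moment 0 (sqnorm z / (4 * t))).
Proof.
move=> t0; rewrite /integral3 /Rintegral integral_newton_heat//.
under eq_integral.
  move=> u _.
  have -> : newton_cst * gauss_conv t u (z 0 0) * gauss_conv t u (z 1 0) *
    gauss_conv t u (z 2 0) = newton_cst * ((Num.sqrt (1 + 4 * t * u ^+ 2))^-1 ^+ 3 *
     expR (- (sqnorm z * gauss_subst t u ^+ 2))).
    have -> : gauss_subst t u ^+ 2 = u ^+ 2 / (1 + 4 * t * u ^+ 2).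
      by rewrite exprMn exprVn sqr_sqrtr//; exact/ltW/gauss_conv_denom_gt0.
    by rewrite /gauss_conv sqnormE !(mulrDl _ _ (_ / _)) !opprD !expRD; ring.
  over.
rewrite integralT_scale ?newton_cst_ge0//.
- by rewrite integral_gauss_subst ?sqnorm_ge0//=; ring.
- apply: measurable_funM.
    apply: measurable_funX; apply: continuous_measurable_fun => u.
    have D := gauss_conv_denom_gt0 t u t0.
    apply: cvgV; first by rewrite gt_eqF// sqrtr_gt0.
    apply: (continuous_comp (f := fun u => 1 + 4 * t * u ^+ 2)
       (g := Num.sqrt)); last exact: sqrt_continuous.
    apply: (@has_deriv_continuous _ _ u); apply: has_derivD (has_deriv_cst _ _) _.
    exact: has_derivM (has_deriv_cst _ _) (has_derivX _ (has_deriv_id _)).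
  apply: continuous_measurable_fun => u.
  apply: (@has_deriv_continuous _ _ u); apply: has_deriv_comp (has_deriv_expR _) _.
  apply: has_derivN; apply: has_derivM (has_deriv_cst _ _) _.
  exact: has_derivX _ (has_deriv_gauss_subst t u t0).
Qed.

End NewtonPotential.

(** * Symbols *)

(* Polynomials in the coordinates of z and in the functions
   moment m z t = (4 t)^(- m - 1/2) g_m(|z|^2 / (4 t)), which are closed under
   differentiation in z and t. *)
Inductive symbol (R : Type) : Type :=
| Cst of R
| Crd of 'I_3
| Mom of nat
| Add of symbol R & symbol R
| Mul of symbol R & symbol R.
Arguments Crd {R}.
Arguments Mom {R}.
Arguments Cst {R}.
Arguments Add {R}.
Arguments Mul {R}.

Section Symbols.
Context {R : realType}.
Implicit Types (s t : R) (z : 'cV[R]_3) (i j : 'I_3) (e f : symbol R).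

Definition moment m z t : R :=
  (Num.sqrt (4 * t))^-1 ^+ m.*2.+1 * gauss_moment m (sqnorm z / (4 * t)).

Fixpoint ev z t e : R :=
  match e with
  | Cst c => c
  | Crd i => z i 0
  | Mom m => moment m z t
  | Add e f => ev z t e + ev z t f
  | Mul e f => ev z t e * ev z t f
  end.

Definition Sqn : symbol R :=
  Add (Add (Mul (Crd 0) (Crd 0)) (Mul (Crd 1) (Crd 1))) (Mul (Crd 2) (Crd 2)).

Fixpoint Dx i e : symbol R :=
  match e with
  | Cst _ => Cst 0
  | Crd j => Cst (i == j)%:R
  | Mom m => Mul (Cst (- 2)) (Mul (Crd i) (Mom m.+1))
  | Add e f => Add (Dx i e) (Dx i f)
  | Mul e f => Add (Mul (Dx i e) f) (Mul e (Dx i f))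
  end.

(** For [Mom m] the chain rule leaves moments divided by 4 t, and 1 / t is not in the algebra. The
    expression (2m + 1) g_m - 2 y g_(m+1) equals exp(- y) for every m, so its index can be raised by
    one, which removes the division. For m = 0 the result is the heat equation. *)
Fixpoint Dt e : symbol R :=
  match e with
  | Cst _ => Cst 0
  | Crd _ => Cst 0
  | Mom m => Add (Mul (Cst (- 2 * m.+1.*2.+1%:R)) (Mom m.+1))
                 (Mul (Cst 4) (Mul Sqn (Mom m.+2)))
  | Add e f => Add (Dt e) (Dt f)
  | Mul e f => Add (Mul (Dt e) f) (Mul e (Dt f))
  end.

Lemma has_deriv_sum n (h : 'I_n -> R -> R) s (dh : 'I_n -> R) :
  (forall k, has_deriv (h k) s (dh k)) ->
  has_deriv (fun s => \sum_(k < n) h k s) s (\sum_(k < n) dh k).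
Proof.
move=> H; have -> : (fun s => \sum_(k < n) h k s) = \sum_(k < n) h k.
  by apply/funext => x; rewrite fct_sumE.
exact: is_derive_sum.
Qed.

Section Curve.
Variables (z : R -> 'cV[R]_3) (th : R -> R) (s : R) (dz : 'I_3 -> R) (dth : R).
Hypothesis th0 : 0 < th s.
Hypothesis z' : forall i, has_deriv (fun s => z s i 0) s (dz i).
Hypothesis th' : has_deriv th s dth.

Lemma has_deriv_sqnorm :
  has_deriv (fun s => sqnorm (z s)) s (2 * \sum_i dz i * z s i 0).
Proof.
apply: has_deriv_eq (has_deriv_sum 3 (fun i s => z s i 0 ^+ 2) s _ _) _.
  by move=> i; exact: has_derivX _ (z' i).
by rewrite mulr_sumr; apply: eq_bigr => i _; rewrite /= expr1; ring.
Qed.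

Lemma has_deriv_moment m : has_deriv (fun s => moment m (z s) (th s)) s
  (- 2 * moment m.+1 (z s) (th s) * (\sum_i dz i * z s i 0) +
   dth * (- 2 * m.+1.*2.+1%:R * moment m.+1 (z s) (th s) +
     4 * (sqnorm (z s) * moment m.+2 (z s) (th s)))).
Proof.
have t4 : 0 < 4 * th s by rewrite mulr_gt0.
have s0 : 0 < Num.sqrt (4 * th s) by rewrite sqrtr_gt0.
have d4 : has_deriv (fun s => 4 * th s) s (4 * dth).
  by apply: has_deriv_eq (has_derivM (has_deriv_cst _ _) th') _; ring.
have da := has_derivV (has_deriv_sqrt d4 t4) (lt0r_neq0 s0).
have dy := has_derivM has_deriv_sqnorm (has_derivV d4 (lt0r_neq0 t4)).
apply: has_deriv_eq.
  exact: has_derivM (has_derivX m.*2.+1 da) (has_deriv_comp (has_deriv_gauss_moment m _) dy).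
have ss : 4 * th s = Num.sqrt (4 * th s) ^+ 2 by rewrite sqr_sqrtr// ltW.
(* Both sides equal exp(- y) with y = |z|^2 / (4 t). *)
have E : m.*2.+1%:R * gauss_moment m (sqnorm (z s) / (4 * th s)) -
  2 * (sqnorm (z s) / (4 * th s)) * gauss_moment m.+1 (sqnorm (z s) / (4 * th s)) =
  m.+1.*2.+1%:R * gauss_moment m.+1 (sqnorm (z s) / (4 * th s)) -
  2 * (sqnorm (z s) / (4 * th s)) * gauss_moment m.+2 (sqnorm (z s) / (4 * th s)).
  by rewrite !gauss_moment_rec; ring.
rewrite /moment; move: E.
move: (gauss_moment m _) (gauss_moment m.+1 _) (gauss_moment m.+2 _) => g0 g1 g2.
move: (\sum_i _) (sqnorm _) => Q q; rewrite [in X in _ -> X]/=.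
move: (Num.sqrt _) ss s0 => r -> r0; rewrite !doubleS !exprS.
have rn : r != 0 by rewrite gt_eqF.
move: (m.*2.+1%:R) (m.*2.+3%:R) => n1 n3 E.
move: (r^-1 ^+ m.*2) => A; apply/eqP; rewrite -subr_eq0; apply/eqP.
transitivity (- 2 * r^-1 ^+ 3 * A * dth * ((n1 * g0 - 2 * (q / r ^+ 2) * g1) -
  (n3 * g1 - 2 * (q / r ^+ 2) * g2))).
  by field.
by move: E; rewrite expr0 mulr1 -expr2 => ->; rewrite subrr mulr0.
Qed.

(** An arbitrary curve in (z, t) covers both uses: lines at fixed time, for partial derivatives, and
    t -> (x - tau t e_1, t), for the integration by parts. *)
Lemma has_deriv_ev e : has_deriv (fun s => ev (z s) (th s) e) s
  (\sum_i dz i * ev (z s) (th s) (Dx i e) + dth * ev (z s) (th s) (Dt e)).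
Proof.
elim: e => [c|j|m|e IHe f IHf|e IHe f IHf] /=.
- apply: has_deriv_eq (has_deriv_cst _ _) _.
  by rewrite mulr0 addr0 big1// => i _; rewrite mulr0.
- apply: has_deriv_eq (z' j) _.
  rewrite mulr0 addr0 (bigD1 j)//= eqxx mulr1 big1 ?addr0// => i ij.
  by rewrite (negbTE ij) mulr0.
- apply: has_deriv_eq (has_deriv_moment m) _; rewrite -sqnormE.
  congr (_ + _); rewrite mulr_sumr; apply: eq_bigr => i _; ring.
- apply: has_deriv_eq (has_derivD IHe IHf) _.
  by rewrite addrACA -big_split/= -mulrDr; congr (_ + _); apply: eq_bigr => i _; rewrite mulrDr.
- apply: has_deriv_eq (has_derivM IHe IHf) _.
  rewrite mulrDl mulrDr addrACA mulr_suml mulr_sumr -big_split/=; congr (_ + _).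
    by apply: eq_bigr => i _; ring.
  ring.
Qed.

End Curve.

(* Weight under the parabolic scaling of (z, t); the constant 0 has every weight. *)
Fixpoint homog (w : int) e : Prop :=
  match e with
  | Cst c => w = 0 \/ c = 0
  | Crd _ => w = -1
  | Mom m => w = m.*2.+1%:Z
  | Add e f => homog w e /\ homog w f
  | Mul e f => exists w1 w2, [/\ w = w1 + w2, homog w1 e & homog w2 f]
  end.

Lemma homog_Sqn : homog (- 2) Sqn.
Proof. by do !split; exists (-1), (-1). Qed.

Lemma homog_Dx i w e : homog w e -> homog (w + 1) (Dx i e).
Proof.
elim: e w => [c|j|m|e IHe f IHf|e IHe f IHf] w /=.
- by move=> _; right.
- by move=> ->; left.
- move=> ->; exists 0, (m.*2.+1%:Z + 1); split; [by rewrite add0r|by left|].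
  exists (-1), (m.+1.*2.+1%:Z); split => //.
  by rewrite doubleS; lia.
- by move=> [he hf]; split; [exact: IHe|exact: IHf].
- move=> [w1 [w2 [-> h1 h2]]]; split.
    by exists (w1 + 1), w2; split; [rewrite addrAC|exact: IHe|].
  by exists w1, (w2 + 1); split; [rewrite addrA| |exact: IHf].
Qed.

Lemma homog_Dt w e : homog w e -> homog (w + 2) (Dt e).
Proof.
elim: e w => [c|j|m|e IHe f IHf|e IHe f IHf] w.
- by move=> _; right.
- by move=> _; right.
- move=> -> /=; split.
    exists 0, (m.+1.*2.+1%:Z); split; [|by left|by []].
    by rewrite doubleS; lia.
  exists 0, (m.*2.+1%:Z + 2); split; [by rewrite add0r|by left|].
  exists (-2), (m.+2.*2.+1%:Z); split => //; last exact: homog_Sqn.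
  by rewrite !doubleS; lia.
- by move=> [he hf]; split; [exact: IHe|exact: IHf].
- move=> [w1 [w2 [-> h1 h2]]]; split.
    by exists (w1 + 2), w2; split; [rewrite addrAC|exact: IHe|].
  by exists w1, (w2 + 2); split; [rewrite -addrA| |exact: IHf].
Qed.

Definition pdist z t : R := Num.sqrt (sqnorm z + 4 * t).

Lemma pdist_gt0 z t : 0 < t -> 0 < pdist z t.
Proof. by move=> t0; rewrite sqrtr_gt0 ltr_wpDl ?sqnorm_ge0 ?mulr_gt0. Qed.

(** With y = |z|^2 / (4 t), the product of sqrt (4 t) and sqrt (1 + y) is the parabolic distance, so
    this is [gauss_moment_bound] rescaled. *)
Lemma moment_bound m : exists2 C : R, 0 <= C &
  forall z t, 0 < t -> `|moment m z t| <= C * pdist z t ^ (- m.*2.+1%:Z).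
Proof.
have [C C0 HC] := gauss_moment_bound (R := R) m; exists C => // z t t0.
have t4 : 0 < 4 * t by rewrite mulr_gt0.
have s0 : 0 < Num.sqrt (4 * t) by rewrite sqrtr_gt0.
have y0 : 0 <= sqnorm z / (4 * t) by rewrite divr_ge0 ?sqnorm_ge0 ?ltW.
have d0 := pdist_gt0 z t t0.
rewrite ger0_norm; last first.
  by rewrite mulr_ge0 ?gauss_moment_ge0 ?exprn_ge0 ?invr_ge0 ?ltW.
rewrite -exprz_inv -exprnP exprVn -ler_pdivrMr ?invr_gt0 ?exprn_gt0// invrK.
have := HC _ y0; have -> : 1 + sqnorm z / (4 * t) = (sqnorm z + 4 * t) * (4 * t)^-1.
  by field; rewrite gt_eqF.
rewrite sqrtrM; last by rewrite addr_ge0 ?sqnorm_ge0 ?ltW.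
rewrite sqrtrV; last exact: ltW.
rewrite exprMn.
rewrite /moment -/(pdist z t) => H; apply: le_trans H.
by rewrite le_eqVlt; apply/orP; left; apply/eqP; ring.
Qed.

Lemma crd_bound i z t : 0 < t -> `|z i 0| <= pdist z t.
Proof.
move=> t0; have t4 : 0 <= 4 * t by rewrite mulr_ge0// ltW.
rewrite -(@ler_pXn2r _ 2)// ?nnegrE ?normr_ge0 ?sqrtr_ge0//.
rewrite sqr_sqrtr ?addr_ge0 ?sqnorm_ge0// real_normK ?num_real//.
rewrite /sqnorm (bigD1 i)//= -addrA lerDl addr_ge0//.
by apply: sumr_ge0 => j _; exact: sqr_ge0.
Qed.

Lemma ev_bound w e : homog w e -> exists2 C : R, 0 <= C &
  forall z t, 0 < t -> `|ev z t e| <= C * pdist z t ^ (- w).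
Proof.
elim: e w => [c|i|m|e IHe f IHf|e IHe f IHf] w /=.
- case=> [->|->]; first by exists `|c| => // z t _; rewrite oppr0 expr0z mulr1.
  by exists 0 => // z t _; rewrite normr0 mul0r.
- by move=> ->; exists 1 => // z t t0; rewrite mul1r opprK expr1z crd_bound.
- by move=> ->; exact: moment_bound.
- move=> [/IHe[C C0 HC] /IHf[D D0 HD]]; exists (C + D); first exact: addr_ge0.
  move=> z t t0; rewrite mulrDl (le_trans (ler_normD _ _))// lerD//; [exact: HC|exact: HD].
- move=> [w1 [w2 [-> /IHe[C C0 HC] /IHf[D D0 HD]]]]; exists (C * D); first exact: mulr_ge0.
  move=> z t t0; rewrite normrM opprD expfzDr ?gt_eqF ?pdist_gt0//.
  by rewrite mulrACA ler_pM//; [exact: HC|exact: HD].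
Qed.

End Symbols.

(** * The Stokes fundamental solution *)

Section Stokes.
Context {R : realType}.
Implicit Types (t : R) (x : 'cV[R]_3) (i j k l : 'I_3) (e : symbol R).

Lemma derive_line (f : 'cV[R]_3 -> R) x (v : 'cV[R]_3) (a : R) :
  has_deriv (fun h => f (x + h *: v)) 0 a -> 'D_v f x = a.
Proof.
move=> H; rewrite -(has_deriv_derive H) /derive.
have -> // : (fun h => h^-1 *: ((f \o shift x) (h *: v) - f x)) =
  (fun h : R => h^-1 *: (((fun h => f (x + h *: v)) \o shift 0) (h *: 1) -
     f (x + 0 *: v))).
apply/funext => h; rewrite /= scale0r !addr0.
by rewrite [h *: 1]mulr1 (addrC x).
Qed.

Lemma has_deriv_coord_line x l i (h : R) :
  has_deriv (fun h => (x + h *: delta_mx l 0) i 0) h (i == l)%:R.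
Proof.
have -> : (fun h => (x + h *: delta_mx l 0) i 0) = (fun h => x i 0 + h * (i == l)%:R).
  by apply/funext => u; rewrite !mxE andbT.
apply: has_deriv_eq.
  exact: has_derivD (has_deriv_cst _ _) (has_derivM (has_deriv_id _) (has_deriv_cst _ _)).
by ring.
Qed.

Lemma has_deriv_ev_line x l t e (h : R) : 0 < t ->
  has_deriv (fun h => ev (x + h *: delta_mx l 0) t e) h
    (ev (x + h *: delta_mx l 0) t (Dx l e)).
Proof.
move=> t0; apply: has_deriv_eq.
  apply: (has_deriv_ev (fun h => x + h *: delta_mx l 0) (fun=> t) h
    (fun i => (i == l)%:R) 0 t0 _ (has_deriv_cst _ _)).
  by move=> i; exact: has_deriv_coord_line.
rewrite mul0r addr0 (bigD1 l)//= eqxx mul1r big1 ?addr0// => i il.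
by rewrite (negbTE il) mul0r.
Qed.

Lemma partial_ev l t e x : 0 < t ->
  partial l (fun z => ev z t e) x = ev x t (Dx l e).
Proof.
move=> t0; apply: derive_line; apply: has_deriv_eq (has_deriv_ev_line x l t e 0 t0) _.
by rewrite scale0r addr0.
Qed.

(** The Gaussian is not a generator, but [gauss_moment_rec] at m = 1 writes it as 3 g_1 - 2 y g_2; m
    = 1 is the index whose power (4 t)^(-3/2) matches the heat kernel. *)
Definition heat_symbol : symbol R :=
  Mul (Cst ((Num.sqrt pi)^-1 ^+ 3))
    (Add (Mul (Cst 3) (Mom 1)) (Mul (Cst (- 2)) (Mul Sqn (Mom 2)))).

Lemma heat_ev x t : 0 < t -> heat x t = ev x t heat_symbol.
Proof.
move=> t0; have t4 : 0 < 4 * t by rewrite mulr_gt0.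
have s0 : 0 < Num.sqrt (4 * t) by rewrite sqrtr_gt0.
have ss : Num.sqrt (4 * t) ^+ 2 = 4 * t by rewrite sqr_sqrtr// ltW.
rewrite /heat enorm_sqr powR_N32; last by rewrite !mulr_gt0 ?pi_gt0.
have -> : 4 * pi * t = pi * (4 * t) by ring.
rewrite sqrtrM ?pi_ge0// invfM exprMn /= /moment -sqnormE -mulrA; congr (_ * _).
have := gauss_moment_rec 1 (sqnorm x / (4 * t)) => E.
have -> : expR (- (sqnorm x / (4 * t))) = 3 * gauss_moment 1 (sqnorm x / (4 * t)) -
   2 * (sqnorm x / (4 * t)) * gauss_moment 2 (sqnorm x / (4 * t)).
  by rewrite E; ring.
move: (gauss_moment 1 _) (gauss_moment 2 _) => g1 g2 /=.
move: (Num.sqrt (4 * t)) s0 ss (sqnorm x) => r r0 <- q; rewrite !exprS !expr0.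
by field; rewrite gt_eqF.
Qed.

Definition stokes_symbol j k : symbol R :=
  Add (Mul (Cst (j == k)%:R) heat_symbol)
    (Dx j (Dx k (Mul (Cst (2 * newton_cst)) (Mom 0)))).

Lemma Tstokes_ev x t j k : 0 < t -> Tstokes x t j k = ev x t (stokes_symbol j k).
Proof.
move=> t0; rewrite /Tstokes mxE heat_ev//; congr (_ + _).
have -> : (fun z => integral3 (fun y => newton (z - y) * heat y t)) =
    (fun z => ev z t (Mul (Cst (2 * newton_cst)) (Mom 0))).
  by apply/funext => z; rewrite newton_heat_potential.
have -> : partial k (fun z => ev z t (Mul (Cst (2 * newton_cst)) (Mom 0))) =
    (fun z => ev z t (Dx k (Mul (Cst (2 * newton_cst)) (Mom 0)))).
  by apply/funext => z; exact: partial_ev.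
exact: partial_ev.
Qed.

Lemma homog_stokes_symbol j k : homog 3 (stokes_symbol j k).
Proof.
split.
  exists 0, 3; split; [by []|by left|].
  exists 0, 3; split; [by []|by left|split].
    by exists 0, 3; split; [by []|by left|by []].
  exists 0, 3; split; [by []|by left|].
  by exists (-2), 5; split; [by []|exact: homog_Sqn|by []].
apply: (@homog_Dx _ _ 2); apply: (@homog_Dx _ _ 1).
by exists 0, 1; split; [by []|by left|by []].
Qed.

End Stokes.

(** * The rotation *)

Section RotationExp.
Context {R : realType}.
Implicit Types (a th rho : R).

Definition rot_axis : 'M[R]_3 := delta_mx 0 0.
Definition rot_plane : 'M[R]_3 := delta_mx 1 1 + delta_mx 2 2.
Definition rot_gen : 'M[R]_3 := delta_mx 2 1 - delta_mx 1 2.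

Lemma Omega_rot_gen rho : Omega rho = rho *: rot_gen.
Proof.
congr (_ *: _); apply/matrixP => i j; rewrite !mxE.
by case: i => [[|[|[|//]]] ?]; case: j => [[|[|[|//]]] ?];
  rewrite /= ?(subr0, sub0r, subrr).
Qed.

Lemma rot_gen_axis : rot_gen * rot_axis = 0.
Proof.
by rewrite mulrBl /rot_axis -!mulmxE !mul_delta_mx_cond /= !mulr0n subrr.
Qed.

Lemma rot_gen_plane : rot_gen * rot_plane = rot_gen.
Proof.
rewrite mulrBl !mulrDr -!mulmxE !mul_delta_mx_cond /=.
by rewrite !mulr0n !mulr1n addr0 add0r.
Qed.

Lemma rot_gen_sqr : rot_gen * rot_gen = - rot_plane.
Proof.
rewrite mulrBl !mulrBr -!mulmxE !mul_delta_mx_cond /=.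
by rewrite !mulr0n !mulr1n subr0 sub0r opprD addrC.
Qed.

Lemma rot_axis_plane : rot_axis + rot_plane = 1.
Proof.
apply/matrixP => i j; rewrite !mxE.
by case: i => [[|[|[|//]]] ?]; case: j => [[|[|[|//]]] ?];
  rewrite /= ?(addr0, add0r).
Qed.

(** The coefficients have the shape of those of the cosine and sine series, for use in
    [cvg_mexp_rot_gen]. At k = 0 the truncated [k.-1] is harmless, since [odd 0] is false; the axis
    projection occurs only there. *)
Lemma rot_gen_exp (k : nat) : rot_gen ^+ k = (k == 0)%:R *: rot_axis +
  ((~~ odd k)%:R * (-1) ^+ k./2) *: rot_plane +
  ((odd k)%:R * (-1) ^+ k.-1./2) *: rot_gen.
Proof.
elim: k => [|k IH]; first by rewrite !expr0 /= mul1r mul0r !scale1r scale0r addr0 rot_axis_plane.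
rewrite exprS IH !mulrDr -!scalerAr rot_gen_axis rot_gen_plane rot_gen_sqr.
rewrite scaler0 scale0r !add0r /= addrC; congr (_ + _).
  rewrite scalerN -scaleNr negbK; congr (_ *: _).
  case: k {IH} => [|k] /=; first by rewrite !mul0r oppr0.
  by rewrite exprS; ring.
Qed.

Lemma cvg_mexp_rot_gen a :
  series (fun k => (k`!%:R)^-1 *: (a *: rot_gen) ^+ k) @ \oo -->
  (rot_axis + cos a *: rot_plane + sin a *: rot_gen : 'M[R]_3).
Proof.
have E n : series (fun k => (k`!%:R)^-1 *: (a *: rot_gen) ^+ k) n =
    series (fun k => (k == 0)%:R : R) n *: rot_axis +
    series (cos_coeff a) n *: rot_plane + series (sin_coeff a) n *: rot_gen.
  rewrite /series /= !scaler_suml -!big_split/=; apply: eq_bigr => k _.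
  rewrite exprZn rot_gen_exp.
  move: rot_axis rot_plane rot_gen => X Y Z.
  rewrite !scalerDr !scalerA /cos_coeff /sin_coeff /= -exprnP.
   congr (_ *: _ + _ *: _ + _ *: _); last 2 first.
  - by rewrite mulrC; ring.
  - by rewrite mulrC; ring.
  by case: k => [|k]; rewrite ?fact0 ?invr1 ?expr0 ?mulr1 // !mulr0.
have -> : series (fun k => (k`!%:R)^-1 *: (a *: rot_gen) ^+ k) =
  (fun n => series (fun k => (k == 0)%:R : R) n *: rot_axis +
    series (cos_coeff a) n *: rot_plane + series (sin_coeff a) n *: rot_gen).
  exact/funext.
apply: cvgD; first apply: cvgD.
- rewrite -[X in _ --> X]scale1r; apply: cvgZr_tmp.
  apply: cvg_near_cst; near=> n; rewrite /series/=.
  have n0 : (0 < n)%N by near: n; exists 1%N.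
  by rewrite -(prednK n0) big_nat_recl//= big1 ?addr0.
- apply: cvgZr_tmp; rewrite unlock; exact: is_cvg_series_cos_coeff.
- apply: cvgZr_tmp; rewrite unlock; exact: is_cvg_series_sin_coeff.
Unshelve. all: by end_near. Qed.

Definition rot_entry th (l k : 'I_3) : R :=
  (rot_axis + cos th *: rot_plane - sin th *: rot_gen) l k.

Lemma mexp_Omega rho t l k : mexp (- t *: Omega rho) l k = rot_entry (rho * t) l k.
Proof.
rewrite /mexp /rot_entry Omega_rot_gen scalerA.
have -> : - t * rho = - (rho * t) by ring.
rewrite (cvg_lim _ (cvg_mexp_rot_gen _))//.
by rewrite cosN sinN scaleNr; reflexivity.
Qed.

End RotationExp.

(** * Oscillatory integrals over the half line *)

Section HalfLine.
Context {R : realType}.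
Local Notation mu := (@lebesgue_measure R).
Local Notation halfline := (`]0%R, +oo[%classic : set (measurableTypeR R)).
Implicit Types (A C M tau r t eps : R) (f g F U W : R -> R).

Lemma halflineP t : halfline t <-> 0 < t.
Proof. by rewrite /= in_itv/= andbT. Qed.

Lemma measurable_halfline f : (forall t, 0 < t -> {for t, continuous f}) ->
  measurable_fun halfline f.
Proof.
move=> cf; apply: open_continuous_measurable_fun; first exact: interval_open.
by move=> t /set_mem /halflineP t0; exact: cf.
Qed.

Lemma ge0_FTCy {F g} eps l : (forall t, eps <= t -> has_deriv F t (g t)) ->
  (forall t, eps <= t -> 0 <= g t) -> (forall t, eps <= t -> {for t, continuous g}) ->
  F t @[t --> +oo] --> l -> (\int[mu]_(t in `[eps, +oo[) (g t)%:E = (l - F eps)%:E)%E.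
Proof.
move=> dF g0 cg Fl; rewrite (ge0_continuous_FTC2y (F := F) (l := l))//.
- apply: continuous_in_subspaceT => t /set_mem; rewrite /= in_itv/= andbT; exact: cg.
- by move=> t /ltW et; exact: has_deriv_derivable (dF t et).
- exact/cvg_at_right_filter/(has_deriv_continuous (dF eps (lexx _))).
- by move=> t; rewrite in_itv/= andbT => /ltW et; exact: has_deriv_derive1 (dF t et).
Qed.

(** * The Lorentzian majorant *)

Definition lorentz A tau r t : R := (A + (tau * t - r) ^+ 2)^-1.

Section Lorentz.
Variables (A tau r : R).
Hypotheses (A0 : 0 < A) (tau0 : 0 < tau).
Local Notation h := (lorentz A tau r).

Lemma lorentz_gt0 t : 0 < h t.
Proof. by rewrite invr_gt0 ltr_wpDr ?sqr_ge0. Qed.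

Lemma lorentz_le t : h t <= A^-1.
Proof. by rewrite lef_pV2 ?posrE ?ltr_wpDr ?sqr_ge0// lerDl sqr_ge0. Qed.

Lemma continuous_lorentz : continuous h.
Proof.
move=> t; apply: has_deriv_continuous; apply: has_derivV.
  apply: has_derivD (has_deriv_cst _ _) _; apply: has_derivX.
  exact: has_derivD (has_derivM (has_deriv_cst _ _) (has_deriv_id _)) (has_deriv_cst _ _).
by rewrite gt_eqF// ltr_wpDr ?sqr_ge0.
Qed.

Definition lorentz_primitive t := (tau * Num.sqrt A)^-1 * atan ((tau * t - r) * (Num.sqrt A)^-1).

Lemma has_deriv_lorentz_primitive t : has_deriv lorentz_primitive t (h t).
Proof.
have s0 : 0 < Num.sqrt A by rewrite sqrtr_gt0.
have ss : Num.sqrt A ^+ 2 = A by rewrite sqr_sqrtr// ltW.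
apply: has_deriv_eq.
  apply: has_derivM (has_deriv_cst _ _) _.
  apply: has_deriv_comp (has_deriv_atan _) _.
  apply: has_derivM (has_deriv_cst _ _).
  exact: has_derivD (has_derivM (has_deriv_cst _ _) (has_deriv_id _)) (has_deriv_cst _ _).
rewrite /lorentz; move: (Num.sqrt A) s0 ss => s s0 <-.
have n1 : s ^+ 2 + (tau * t - r) ^+ 2 != 0 by rewrite gt_eqF// ltr_wpDr ?sqr_ge0// exprn_gt0.
by field; rewrite n1 !gt_eqF.
Qed.

Lemma cvg_lorentz_primitive :
  lorentz_primitive t @[t --> +oo] --> (tau * Num.sqrt A)^-1 * (pi / 2).
Proof.
apply: cvgM; first exact: cvg_cst.
apply: (cvg_comp (fun t => (tau * t - r) * (Num.sqrt A)^-1) atan); last exact: cvgy_atan.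
have s0 : 0 < (Num.sqrt A)^-1 by rewrite invr_gt0 sqrtr_gt0.
apply/cvgryPge => B; near=> t.
rewrite -ler_pdivrMr// lerBrDr -ler_pdivrMl//.
Unshelve. all: by end_near. Qed.

Lemma cvg_lorentz : h t @[t --> +oo] --> (0 : R).
Proof.
apply/(gtr0_cvgV0 (f := fun t => A + (tau * t - r) ^+ 2)).
  by near=> t; rewrite ltr_wpDr ?sqr_ge0.
apply/cvgryPge => B; near=> t.
have tB : `|B| + 1 <= tau * t - r.
  by rewrite lerBrDr -ler_pdivrMl.
have := ler_norm B; have := normr_ge0 B; move: (tau * t - r) tB => x xB B0 BB.
have : x <= x ^+ 2 by rewrite expr2 ler_peMl//; lra.
by move: A0 => ?; lra.
Unshelve. all: by end_near. Qed.

Lemma integral_lorentz_tail eps :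
  (\int[mu]_(t in `[eps, +oo[) (h t)%:E =
   ((tau * Num.sqrt A)^-1 * (pi / 2) - lorentz_primitive eps)%:E)%E.
Proof.
apply: ge0_FTCy => [t _|t _|t _|]; [exact: has_deriv_lorentz_primitive|
  exact/ltW/lorentz_gt0|exact: continuous_lorentz|exact: cvg_lorentz_primitive].
Qed.

Lemma integrable_lorentz : mu.-integrable halfline (EFin \o h).
Proof.
have mh : measurable_fun setT h by exact: continuous_measurable_fun continuous_lorentz.
have : mu.-integrable `[0%R, +oo[%classic (EFin \o h).
  apply/integrableP; split.
    by apply/measurable_EFinP; exact: measurable_funTS.
  under eq_integral do rewrite /= gtr0_norm ?lorentz_gt0//.
  by rewrite integral_lorentz_tail ltry.
apply: integrableS => //.
by move=> t /=; rewrite !in_itv/= !andbT => /ltW.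
Qed.

(** The right-hand side is the integral over the whole line, hence free of the centre r. *)
Lemma Rintegral_lorentz_le : \int[mu]_(t in halfline) h t <= pi / (tau * Num.sqrt A).
Proof.
rewrite Rintegral_itv_obnd_cbnd; last exact: integrable_lorentz.
rewrite /Rintegral integral_lorentz_tail /= /lorentz_primitive.
rewrite -mulrBr mulrC ler_wpM2r ?invr_ge0 ?mulr_ge0 ?sqrtr_ge0 ?(ltW tau0)//.
by have := atan_gtNpi2 ((tau * 0 - r) / Num.sqrt A); lra.
Qed.

Lemma integrable_dominated {f} C : measurable_fun halfline f ->
  (forall t, 0 < t -> `|f t| <= C * h t) -> mu.-integrable halfline (EFin \o f).
Proof.
move=> mf fC; apply: (@le_integrable _ _ _ mu halfline _ _ (EFin \o (fun t => C * h t))) => //.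
- exact/measurable_EFinP.
- move=> t /halflineP t0; rewrite /= lee_fin.
  exact: le_trans (fC t t0) (ler_norm _).
- exact: (@integrableZl _ _ _ mu _ _ C _ integrable_lorentz).
Qed.

Lemma Rintegral_dominated {f} C : measurable_fun halfline f -> 0 <= C ->
  (forall t, 0 < t -> `|f t| <= C * h t) ->
  `|\int[mu]_(t in halfline) f t| <= C * (pi / (tau * Num.sqrt A)).
Proof.
move=> mf C0 fC; have If := integrable_dominated C mf fC.
apply: le_trans (le_normr_Rintegral _ If) _ => //.
apply: (@le_trans _ _ (\int[mu]_(t in halfline) (C * h t))).
  apply: le_Rintegral => //.
  - exact: integrable_norm If.
  - exact: (@integrableZl _ _ _ mu _ _ C _ integrable_lorentz).
  - by move=> t /halflineP; exact: fC.
rewrite RintegralZl//; last exact: integrable_lorentz.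
by rewrite ler_wpM2l// Rintegral_lorentz_le.
Qed.

End Lorentz.

(** * Integration by parts on the half line *)

Section Oscillation.
Variables (U dU W w : R -> R) (A tau r C M : R).
Hypotheses (A0 : 0 < A) (tau0 : 0 < tau) (C0 : 0 <= C) (M0 : 0 <= M).
Local Notation h := (lorentz A tau r).
Hypothesis U' : forall t, 0 < t -> has_deriv U t (dU t).
Hypothesis cdU : forall t, 0 < t -> {for t, continuous dU}.
Hypothesis W' : forall t, has_deriv W t (w t).
Hypothesis cw : continuous w.
Hypothesis W_0 : W 0 = 0.
Hypothesis UC : forall t, 0 < t -> `|U t| <= C * h t.
Hypothesis dUC : forall t, 0 < t -> `|dU t| <= C * h t.
Hypothesis wM : forall t, `|w t| <= M.
Hypothesis WM : forall t, `|W t| <= M.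

Let g t := dU t * W t + U t * w t.
Let F t := U t * W t.
Let K := 2 * (C * M).

Lemma dominatedM f v : (forall t, 0 < t -> `|f t| <= C * h t) -> (forall t, `|v t| <= M) ->
  forall t, 0 < t -> `|f t * v t| <= (C * M) * h t.
Proof. by move=> fC vM t t0; rewrite normrM mulrAC ler_pM ?fC ?vM. Qed.

Let cU t : 0 < t -> {for t, continuous U}.
Proof. by move=> t0; exact: has_deriv_continuous (U' t t0). Qed.

Let cW t : {for t, continuous W}.
Proof. exact: has_deriv_continuous (W' t). Qed.

Lemma integrable_Uw : mu.-integrable halfline (EFin \o (fun t => U t * w t)).
Proof.
apply: (integrable_dominated A tau r A0 tau0 (C * M)).
  by apply: measurable_halfline => t t0; apply: cvgM; [exact: cU|exact: cw].
exact: dominatedM.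
Qed.

Lemma integrable_dUW : mu.-integrable halfline (EFin \o (fun t => dU t * W t)).
Proof.
apply: (integrable_dominated A tau r A0 tau0 (C * M)).
  by apply: measurable_halfline => t t0; apply: cvgM; [exact: cdU|exact: cW].
exact: dominatedM.
Qed.

Let F' t : 0 < t -> has_deriv F t (g t).
Proof. by move=> t0; exact: has_derivM (U' t t0) (W' t). Qed.

Let cg t : 0 < t -> {for t, continuous g}.
Proof.
move=> t0; apply: cvgD; apply: cvgM; [exact: cdU|exact: cW|exact: cU|exact: cw].
Qed.

Let gK t : 0 < t -> `|g t| <= K * h t.
Proof.
move=> t0; apply: le_trans (ler_normD _ _) _; rewrite /K mulr_natl mulr2n mulrDl.
by rewrite lerD ?dominatedM.
Qed.

Let Ig : mu.-integrable halfline (EFin \o g).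
Proof.
apply: (integrable_dominated A tau r A0 tau0 K) gK.
by apply: measurable_halfline => t; exact: cg.
Qed.

Let cvgF : F t @[t --> +oo] --> (0 : R).
Proof.
apply/cvgr0Pnorm_le => e e0.
have L : (C * M) * h t @[t --> +oo] --> (0 : R).
  by rewrite -(mulr0 (C * M)); apply: cvgM; [exact: cvg_cst|exact: cvg_lorentz].
move/cvgr0Pnorm_le : L => /(_ e e0) L; near=> t.
apply: le_trans (dominatedM U W UC WM t _) _; first by near: t; exact: nbhs_pinfty_gt.
apply: le_trans (ler_norm _) _; near: t; exact: L.
Unshelve. all: by end_near. Qed.

(** The fundamental theorem [ge0_FTCy] asks for a nonnegative integrand and g has no sign. Adding K
    h, which dominates |g| and has an explicit primitive, makes it nonnegative; the integral of K h
    is then subtracted. *)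
Let tail eps : 0 < eps -> \int[mu]_(t in `[eps, +oo[) g t = - F eps.
Proof.
move=> e0; have eps0 t : eps <= t -> 0 < t by exact: lt_le_trans.
have H0 t : eps <= t -> 0 <= K * h t by move=> _; rewrite !mulr_ge0// ltW// lorentz_gt0.
have dKH t : has_deriv (fun t => K * lorentz_primitive A tau r t) t (K * h t).
  have dH := has_deriv_lorentz_primitive A tau r A0 tau0 t.
  by apply: has_deriv_eq (has_derivM (has_deriv_cst _ _) dH) _; ring.
have E1 : (\int[mu]_(t in `[eps, +oo[) (K * h t)%:E =
    (K * ((tau * Num.sqrt A)^-1 * (pi / 2)) - K * lorentz_primitive A tau r eps)%:E)%E.
  apply: (ge0_FTCy (F := fun t => K * lorentz_primitive A tau r t)) => //.
  - by move=> t _; apply: cvgM; [exact: cvg_cst|exact: continuous_lorentz].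
  - by apply: cvgM; [exact: cvg_cst|exact: cvg_lorentz_primitive].
have E2 : (\int[mu]_(t in `[eps, +oo[) (g t + K * h t)%:E =
    ((0 + K * ((tau * Num.sqrt A)^-1 * (pi / 2))) -
     (F eps + K * lorentz_primitive A tau r eps))%:E)%E.
  apply: (ge0_FTCy (F := fun t => F t + K * lorentz_primitive A tau r t)).
  - by move=> t et; exact: has_derivD (F' t (eps0 t et)) (dKH t).
  - move=> t et; have := gK t (eps0 t et); rewrite ler_norml => /andP[+ _]; lra.
  - move=> t et; apply: cvgD; first exact: cg (eps0 t et).
    by apply: cvgM; [exact: cvg_cst|exact: continuous_lorentz].
  - apply: cvgD; first exact: cvgF.
    by apply: cvgM; [exact: cvg_cst|exact: cvg_lorentz_primitive].
have sub : `[eps, +oo[%classic `<=` halfline.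
  by move=> t /=; rewrite !in_itv/= !andbT; exact: eps0.
have Ig' : mu.-integrable `[eps, +oo[%classic (EFin \o g).
  by apply: integrableS Ig => //.
have Ih' : mu.-integrable `[eps, +oo[%classic (EFin \o (fun t => K * h t)).
  apply: (@integrableS _ _ _ mu halfline) => //.
  exact: (@integrableZl _ _ _ mu _ _ K _ (integrable_lorentz A tau r A0 tau0)).
have := @RintegralD _ _ _ mu `[eps, +oo[%classic g (fun t => K * h t) (measurable_itv _) Ig' Ih'.
rewrite /Rintegral E1 E2 /=.
by move=> E; lra.
Qed.

(** The claim is that the integral of (U W)' vanishes. Since U is controlled only for t > 0, the
    half line is cut at eps: the tail is - U(eps) W(eps), where |W(eps)| <= M eps because W(0) = 0,
    and the piece over ]0, eps] is O(eps) because the Lorentzian is at most 1 / A. *)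
Lemma oscillation_by_parts :
  \int[mu]_(t in halfline) (U t * w t) = - \int[mu]_(t in halfline) (dU t * W t).
Proof.
apply/eqP; rewrite -addr_eq0 addrC -RintegralD//; last 2 first.
- exact: integrable_dUW.
- exact: integrable_Uw.
rewrite -[X in X == 0]/(\int[mu]_(t in halfline) g t).
rewrite -normr_le0; apply/ler_addgt0Pr => e e0; rewrite add0r.
(* The two contributions add up to at most L eps; dividing by L + 1 below avoids a zero
   denominator. *)
pose L := (K * A^-1 + C * A^-1 * M); have A1 : 0 <= A^-1 by rewrite invr_ge0 ltW.
have L0 : 0 <= L by rewrite addr_ge0 ?mulr_ge0.
pose eps := e / (L + 1); have L1 : 0 < L + 1 by rewrite ltr_wpDl.
have eps0 : 0 < eps by rewrite divr_gt0.
have := Rintegral_itvB (x := eps) Ig; rewrite !bnd_simp => /(_ (ltW eps0) isT) /eqP.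
rewrite subr_eq => /eqP ->.
rewrite Rintegral_itv_obnd_cbnd; last first.
  by apply: integrableS Ig => // t /=; rewrite !in_itv/= !andbT; exact: lt_trans.
rewrite tail//; apply: le_trans (ler_normD _ _) _; rewrite normrN.
have WE : `|W eps| <= M * eps.
  have [c _] := MVT_segment (ltW eps0) (fun t _ => W' t)
     (continuous_subspaceT (fun t => cW t)).
  by rewrite W_0 !subr0 => ->; rewrite normrM (gtr0_norm eps0) ler_wpM2r// ltW.
have FE : `|F eps| <= (C * A^-1 * M) * eps.
  rewrite normrM -mulrA ler_pM//.
  by apply: le_trans (UC eps eps0) _; rewrite ler_wpM2l// lorentz_le.
have IE : `|\int[mu]_(t in `]0, eps]) g t| <= (K * A^-1) * eps.
  have sub : `]0, eps]%classic `<=` halfline.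
    by move=> t /=; rewrite !in_itv/= andbT => /andP[].
  have Ig' : mu.-integrable `]0, eps]%classic (EFin \o g) by apply: integrableS Ig => //.
  apply: le_trans (le_normr_Rintegral _ Ig') _ => //.
  have -> : (K * A^-1) * eps = \int[mu]_(t in `]0, eps]) (K * A^-1).
    by rewrite Rintegral_cst//= lebesgue_measure_itv/= lte_fin eps0 -EFinD subr0.
  apply: le_Rintegral => //; first exact: integrable_norm Ig'.
    apply: (@integrableS _ _ _ mu `[0%R, eps]%classic) => //.
      by move=> t /=; rewrite !in_itv/= => /andP[/ltW -> ->].
    apply: continuous_compact_integrable; first exact: segment_compact.
    by apply: continuous_subspaceT => ?; exact: cst_continuous.
  move=> t /= /sub /halflineP t0; apply: le_trans (gK t t0) _.
  by rewrite ler_wpM2l ?mulr_ge0// lorentz_le.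
apply: le_trans (lerD FE IE) _; rewrite -mulrDl addrC -/L /eps.
by rewrite mulrA ler_pdivrMr// mulrC ler_wpM2l ?ltW// ltrDl.
Qed.

End Oscillation.

End HalfLine.

(** * Geometry of the wake *)

Section Path.
Context {R : realType}.
Variables (tau r0 : R).
Hypotheses (tau0 : 0 < tau) (r00 : 0 < r0).
Implicit Types (t h : R) (x z : 'cV[R]_3) (i j k l : 'I_3) (e f : symbol R).

Definition oseen_path x t : 'cV[R]_3 := x - (tau * t) *: e1 R.

Lemma e1E i : e1 R i 0 = (i == 0)%:R.
Proof. by rewrite mxE; case: i => [[|[|[|//]]] ?]. Qed.

Lemma oseen_pathE x t i : oseen_path x t i 0 = x i 0 - tau * t * (i == 0)%:R.
Proof. by rewrite !mxE -e1E mxE. Qed.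

Lemma path_line x l h t : oseen_path (x + h *: delta_mx l 0) t = oseen_path x t + h *: delta_mx l 0.
Proof. by rewrite /oseen_path addrAC. Qed.

Definition drift e : symbol R := Add (Dt e) (Mul (Cst (- tau)) (Dx 0 e)).

Lemma has_deriv_path x t e : 0 < t ->
  has_deriv (fun t => ev (oseen_path x t) t e) t (ev (oseen_path x t) t (drift e)).
Proof.
move=> t0; apply: has_deriv_eq.
  apply: (has_deriv_ev (oseen_path x) (fun t => t) t (fun i => - (tau * (i == 0)%:R)) 1 t0
    _ (has_deriv_id _)).
  move=> i; have -> : (fun t => oseen_path x t i 0) = (fun t => x i 0 + - (tau * (i == 0)%:R) * t).
    by apply/funext => s; rewrite oseen_pathE; ring.
  have dM := has_derivM (has_deriv_cst (- (tau * (i == 0)%:R)) t) (has_deriv_id t).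
  by apply: has_deriv_eq (has_derivD (has_deriv_cst (x i 0) t) dM) _; ring.
rewrite (bigD1 0)//= big1 => [|i /negbTE ->]; last by rewrite mulr0 oppr0 mul0r.
by rewrite mulr1; ring.
Qed.

Lemma continuous_path x t e : 0 < t -> {for t, continuous (fun t => ev (oseen_path x t) t e)}.
Proof. by move=> t0; exact: has_deriv_continuous (has_deriv_path x t e t0). Qed.

Lemma coord0_le_enorm x : `|x 0 0| <= enorm x.
Proof.
rewrite /enorm -sqrtr_sqr ler_wsqrtr// -/(sqnorm x) sqnormE -addrA lerDl.
by rewrite addr_ge0 ?sqr_ge0.
Qed.

Lemma sqnorm_path x t : sqnorm (oseen_path x t) =
  (enorm x - tau * t) ^+ 2 + 2 * (tau * t) * (enorm x - x 0 0).
Proof.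
rewrite sqrrB enorm_sqr !sqnormE !oseen_pathE /=; ring.
Qed.

Definition wake_size x : R := enorm x * wake x.
(** The terms come from [pdist_path_ge]: 9 + 4 / r0 from the times with tau t < |x| / 2, while tau
    lets 4 t control |x| when tau t >= |x| / 2. *)
Definition path_cst : R := (9 + 4 / r0 + tau)^-1.

Lemma wake_ge1 x : 1 <= wake x.
Proof. by rewrite /wake -addrA lerDl subr_ge0 (le_trans (ler_norm _) (coord0_le_enorm x)). Qed.

Lemma wake_size_ge x : r0 <= enorm x -> r0 <= wake_size x.
Proof.
move=> rx; have := wake_ge1 x; rewrite /wake_size => w1.
by apply: le_trans rx _; rewrite ler_peMr// /enorm sqrtr_ge0.
Qed.

Lemma path_cst_gt0 : 0 < path_cst.
Proof. by rewrite invr_gt0 !addr_gt0 ?divr_gt0. Qed.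

(** By [sqnorm_path] the squared distance is (|x| - tau t)^2 + 2 tau t (|x| - x_1) + 4 t. Once tau t
    >= |x| / 2, the last two terms control |x| (|x| - x_1) and |x|. Before that, |x| - tau t exceeds
    |x| / 2 and its square controls both, since |x| <= |x|^2 / r0. *)
Lemma pdist_path_ge x t : r0 <= enorm x -> 0 < t ->
  path_cst * (wake_size x + (tau * t - enorm x) ^+ 2) <= pdist (oseen_path x t) t ^+ 2.
Proof.
move=> rx t0; rewrite sqr_sqrtr; last by rewrite addr_ge0 ?sqnorm_ge0 ?mulr_ge0 ?ltW.
rewrite sqnorm_path /wake_size /wake.
have := coord0_le_enorm x; rewrite ler_norml => /andP[x1 x2].
have a0 : 0 < tau * t by rewrite mulr_gt0.
have -> : 4 * t = 4 * (tau * t) / tau by field; rewrite gt_eqF.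
move: (enorm x) (x 0 0) (tau * t) rx x1 x2 a0 => r y a rx x1 x2 a0.
have rp : 0 < r by exact: lt_le_trans rx.
rewrite /path_cst; set D := 9 + _ + _.
have q0 : 0 < 4 / r0 by rewrite divr_gt0.
have tau0' : 0 < tau by exact: tau0.
have D9 : 9 <= D by rewrite /D; lra.
have Dt' : tau <= D by rewrite /D; lra.
have Dr : 9 + 4 / r0 <= D by rewrite /D; lra.
have D0 : 0 < D by lra.
rewrite ler_pdivrMl//.
have [ar|ar] := leP (r / 2) a.
  have H1 : (a - r) ^+ 2 <= D * (r - a) ^+ 2.
    have -> : (r - a) ^+ 2 = (a - r) ^+ 2 by ring.
    by rewrite ler_peMl ?sqr_ge0//; lra.
  have H2 : r * (r - y) <= D * (2 * a * (r - y)).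
    rewrite mulrA ler_wpM2r ?subr_ge0//.
    have : 9 * (2 * a) <= D * (2 * a) by rewrite ler_wpM2r// mulr_ge0// ltW.
    lra.
  have H3 : r <= D * (4 * a / tau).
    rewrite mulrA ler_pdivlMr//.
    have : tau * (4 * a) <= D * (4 * a) by rewrite ler_wpM2r// mulr_ge0// ltW.
    have : r * tau <= 2 * a * tau by rewrite ler_wpM2r ?(ltW tau0)//; lra.
    move: (mulr_gt0 a0 tau0) => ? ? ?; lra.
  by lra.
(* Of the 9, eight come from |x| (|x| - x_1) <= 2 |x|^2 and one from (tau t - |x|)^2 itself; 4 / r0
   comes from |x|. *)
have H1 : r ^+ 2 <= 4 * (r - a) ^+ 2.
  have : 0 <= (r - 2 * a) * (3 * r - 2 * a) by rewrite mulr_ge0//; lra.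
  by lra.
have H2 : r <= r ^+ 2 / r0 by rewrite ler_pdivlMr// expr2 ler_wpM2l// ltW.
have H3 : r ^+ 2 / r0 <= (4 / r0) * (r - a) ^+ 2.
  have -> : 4 / r0 * (r - a) ^+ 2 = 4 * (r - a) ^+ 2 / r0 by ring.
  by rewrite ler_wpM2r// invr_ge0 ltW.
have H4 : r * (r - y) <= 2 * r ^+ 2.
  have : 0 <= r * (r + y) by rewrite mulr_ge0 ?(ltW rp)//; lra.
  by lra.
have H5 : (9 + 4 / r0) * (r - a) ^+ 2 <= D * (r - a) ^+ 2 by rewrite ler_wpM2r ?sqr_ge0.
have H6 : 0 <= D * (2 * a * (r - y)) by rewrite !mulr_ge0 ?subr_ge0 ?(ltW D0) ?(ltW a0).
have H7 : 0 <= D * (4 * a / tau) by rewrite !mulr_ge0 ?invr_ge0 ?(ltW D0) ?(ltW a0) ?(ltW tau0).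
have -> : r * (1 + r - y) + (a - r) ^+ 2 = r + r * (r - y) + (r - a) ^+ 2 by ring.
by rewrite !mulrDr; lra.
Qed.

(** The triangle inequality in squared form: a displacement by at most half the parabolic distance
    leaves at least half of it. *)
Lemma pdist_line_ge z l h t : 0 < t -> 4 * h ^+ 2 <= pdist z t ^+ 2 ->
  pdist z t ^+ 2 <= 4 * pdist (z + h *: delta_mx l 0) t ^+ 2.
Proof.
move=> t0; rewrite !sqr_sqrtr ?addr_ge0 ?sqnorm_ge0 ?mulr_ge0 ?(ltW t0)//.
rewrite /sqnorm (bigD1 l)//= [in X in _ -> _ <= X](bigD1 l)//=.
rewrite [X in _ -> _ <= 4 * (_ + X + _)](eq_bigr (fun i => z i 0 ^+ 2)); last first.
  by move=> i /negbTE il; rewrite !mxE il /= mulr0 addr0.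
have : 0 <= \sum_(i < 3 | i != l) z i 0 ^+ 2 by apply: sumr_ge0 => i _; exact: sqr_ge0.
rewrite !mxE eqxx /= mulr1; move: (\sum_(i < 3 | _) _) (z l 0) => s y s0 H.
have := sqr_ge0 (y + 2 * h); nra.
Qed.

Lemma pdist_path_line_ge x l h t : r0 <= enorm x -> 0 < t ->
  4 * h ^+ 2 <= path_cst * wake_size x ->
  path_cst / 4 * (wake_size x + (tau * t - enorm x) ^+ 2) <=
    pdist (oseen_path (x + h *: delta_mx l 0) t) t ^+ 2.
Proof.
move=> rx t0 hx; have P := pdist_path_ge x t rx t0.
have c0 := path_cst_gt0.
have L := pdist_line_ge (oseen_path x t) l h t t0.
rewrite path_line; suff /L : 4 * h ^+ 2 <= pdist (oseen_path x t) t ^+ 2 by lra.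
apply: le_trans hx (le_trans _ P); rewrite ler_wpM2l ?(ltW c0)//.
by rewrite lerDl sqr_ge0.
Qed.

(** Free of t, so that one range of displacements h serves the whole path. *)
Definition near_line x h := 4 * h ^+ 2 <= path_cst * wake_size x.

(** Of the n + 2 powers of decay, two are kept as the Lorentzian, to be integrated in t, and the
    other n are bounded by their value at tau t = |x|. *)
Lemma path_bound n e : homog n.+2%:Z e -> exists2 C : R, 0 <= C &
  forall x l h t, r0 <= enorm x -> near_line x h -> 0 < t ->
  `|ev (oseen_path (x + h *: delta_mx l 0) t) t e| <=
    C * (Num.sqrt (wake_size x))^-1 ^+ n * lorentz (wake_size x) tau (enorm x) t.
Proof.
move=> /ev_bound[C C0 HC]; have c0 := path_cst_gt0.
pose k := Num.sqrt (path_cst / 4); have c4 : 0 < path_cst / 4 by exact: divr_gt0.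
have k0 : 0 < k by rewrite sqrtr_gt0.
exists (C * k^-1 ^+ n.+2); first by rewrite mulr_ge0 ?exprn_ge0 ?invr_ge0 ?(ltW k0).
move=> x l h t rx hx t0; apply: le_trans (HC _ t t0) _.
rewrite -[leRHS]mulrA -[leRHS]mulrA ler_wpM2l//.
have P := pdist_path_line_ge x l h t rx t0 hx.
have d0 := pdist_gt0 (oseen_path (x + h *: delta_mx l 0) t) t t0.
move: (pdist _ _) P d0 => d P d0.
have A0 : 0 < wake_size x by exact: lt_le_trans r00 (wake_size_ge x rx).
rewrite /lorentz; move: (wake_size x) (tau * t - enorm x) A0 P => A w A0 P.
have Q0 : 0 < A + w ^+ 2 by rewrite ltr_wpDr ?sqr_ge0.
pose q := Num.sqrt (A + w ^+ 2); have q0 : 0 < q by rewrite sqrtr_gt0.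
have qq : (A + w ^+ 2)^-1 = q^-1 ^+ 2 by rewrite exprVn sqr_sqrtr// ltW.
have s0 : 0 < Num.sqrt A by rewrite sqrtr_gt0.
have sq : Num.sqrt A <= q by rewrite ler_wsqrtr// lerDl sqr_ge0.
have kd : k * q <= d.
  rewrite -(@ler_pXn2r _ 2) ?nnegrE ?mulr_ge0 ?(ltW k0) ?(ltW q0) ?(ltW d0)//.
  by rewrite exprMn !sqr_sqrtr ?(ltW Q0) ?(ltW c4).
rewrite qq -exprz_inv -exprnP.
apply: (@le_trans _ _ ((k * q)^-1 ^+ n.+2)).
  rewrite lerXn2r ?nnegrE ?invr_ge0 ?mulr_ge0 ?(ltW k0) ?(ltW q0) ?(ltW d0)//.
  by rewrite lef_pV2 ?posrE ?mulr_gt0.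
rewrite invfM exprMn ler_wpM2l ?exprn_ge0 ?invr_ge0 ?(ltW k0)//.
rewrite -{1}[n.+2]addn2 exprD ler_wpM2r ?sqr_ge0//.
by rewrite lerXn2r ?nnegrE ?invr_ge0 ?(ltW q0) ?(ltW s0)// lef_pV2.
Qed.

(** The surplus power of the heavier term f costs at most the factor 1 / sqrt r0, as [wake_size x]
    is at least r0. *)
Lemma path_bound_add n e f : homog n.+2%:Z e -> homog n.+3%:Z f ->
  exists2 C : R, 0 <= C &
  forall x l h t, r0 <= enorm x -> near_line x h -> 0 < t ->
  `|ev (oseen_path (x + h *: delta_mx l 0) t) t (Add f e)| <=
    C * (Num.sqrt (wake_size x))^-1 ^+ n * lorentz (wake_size x) tau (enorm x) t.
Proof.
move=> /path_bound[C C0 HC] /path_bound[D D0 HD].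
have s0 : 0 < Num.sqrt r0 by rewrite sqrtr_gt0.
exists (D * (Num.sqrt r0)^-1 + C); first by rewrite addr_ge0 ?mulr_ge0 ?invr_ge0 ?(ltW s0).
move=> x l h t rx hx t0; apply: le_trans (ler_normD _ _) _.
rewrite !mulrDl lerD ?HC//; apply: le_trans (HD x l h t rx hx t0) _.
have A0 : 0 < wake_size x by exact: lt_le_trans r00 (wake_size_ge x rx).
have sA : 0 < Num.sqrt (wake_size x) by rewrite sqrtr_gt0.
rewrite ler_wpM2r ?(ltW (lorentz_gt0 _ _ _ A0 _))//.
rewrite exprS mulrA ler_wpM2r ?exprn_ge0 ?invr_ge0 ?(ltW sA)// ler_wpM2l//.
by rewrite lef_pV2 ?posrE// ler_wsqrtr// wake_size_ge.
Qed.

Lemma drift_bound n e : homog n.+1%:Z e -> exists2 C : R, 0 <= C &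
  forall x l h t, r0 <= enorm x -> near_line x h -> 0 < t ->
  `|ev (oseen_path (x + h *: delta_mx l 0) t) t (drift e)| <=
    C * (Num.sqrt (wake_size x))^-1 ^+ n * lorentz (wake_size x) tau (enorm x) t.
Proof.
move=> he; apply: path_bound_add.
  exists 0, n.+2%:Z; split; [by rewrite add0r|by left|].
  have -> : n.+2%:Z = n.+1%:Z + 1 by lia.
  exact: homog_Dx.
have -> : n.+3%:Z = n.+1%:Z + 2 by lia.
exact: homog_Dt.
Qed.

Lemma Dx_drift_bound n i e : homog n.+1%:Z e -> exists2 C : R, 0 <= C &
  forall x l h t, r0 <= enorm x -> near_line x h -> 0 < t ->
  `|ev (oseen_path (x + h *: delta_mx l 0) t) t (Dx i (drift e))| <=
    C * (Num.sqrt (wake_size x))^-1 ^+ n.+1 * lorentz (wake_size x) tau (enorm x) t.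
Proof.
move=> he; apply: path_bound_add.
  have -> : n.+3%:Z = n.+2%:Z + 1 by lia.
  apply: (@homog_Dx _ i n.+2%:Z (Mul (Cst (- tau)) (Dx 0 e))).
  exists 0, n.+2%:Z; split; [by rewrite add0r|by left|].
  have -> : n.+2%:Z = n.+1%:Z + 1 by lia.
  exact: homog_Dx.
have -> : n.+4%:Z = n.+1%:Z + 2 + 1 by lia.
by apply: homog_Dx; exact: homog_Dt.
Qed.

End Path.

(** * The theorem *)

Section Oseen.
Context {R : realType}.
Variables (tau rho r0 : R).
Hypotheses (tau0 : 0 < tau) (rho0 : rho != 0) (r00 : 0 < r0).
Local Notation mu := (@lebesgue_measure R).
Local Notation halfline := (`]0%R, +oo[%classic : set (measurableTypeR R)).
Implicit Types (t h : R) (x z : 'cV[R]_3) (i j k l m : 'I_3) (e f : symbol R).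

Definition rot_osc m k t : R :=
  cos (rho * t) * rot_plane m k - sin (rho * t) * rot_gen m k.

Definition rot_prim m k t : R :=
  rho^-1 * (sin (rho * t) * rot_plane m k + (cos (rho * t) - 1) * rot_gen m k).

(** One constant for the oscillating factor and its primitive; the 2 bounds |cos - 1|. *)
Definition rot_bound m k : R :=
  (1 + `|rho^-1|) * (`|rot_plane m k : R| + 2 * `|rot_gen m k : R|).

Lemma rot_entry_osc m k t : k != 0 -> rot_entry (rho * t) m k = rot_osc m k t.
Proof.
move=> /negbTE k0; have : rot_axis m k = 0 :> R by rewrite mxE k0 andbF.
rewrite /rot_entry /rot_osc; move: rot_axis rot_plane rot_gen => X P J X0.
by rewrite !mxE X0 add0r.
Qed.

Lemma has_deriv_rot_prim m k t : has_deriv (rot_prim m k) t (rot_osc m k t).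
Proof.
have dl : has_deriv (fun t => rho * t) t rho.
  by apply: has_deriv_eq (has_derivM (has_deriv_cst _ _) (has_deriv_id _)) _; ring.
have ds := has_deriv_comp (is_derive_sin (rho * t) : has_deriv sin (rho * t) _) dl.
have dc := has_deriv_comp (is_derive_cos (rho * t) : has_deriv cos (rho * t) _) dl.
apply: has_deriv_eq.
  apply: has_derivM (has_deriv_cst _ _) (has_derivD (has_derivM ds (has_deriv_cst _ _)) _).
  exact: has_derivM (has_derivD dc (has_deriv_cst _ _)) (has_deriv_cst _ _).
rewrite /rot_osc; move: (rot_plane m k) (rot_gen m k) => a b; field.
exact: rho0.
Qed.

Lemma continuous_rot_osc m k : continuous (rot_osc m k).
Proof.
move=> t; have cl : {for t, continuous (fun t => rho * t)}.
  by apply: cvgM; [exact: cvg_cst|exact: cvg_id].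
apply: cvgB; apply: cvgM; try exact: cvg_cst.
  exact: continuous_comp cl (@continuous_cos _ _).
exact: continuous_comp cl (@continuous_sin _ _).
Qed.

Lemma rot_prim0 m k : rot_prim m k 0 = 0.
Proof. by rewrite /rot_prim mulr0 sin0 cos0 subrr !mul0r addr0 mulr0. Qed.

Lemma rot_bound_ge0 m k : 0 <= rot_bound m k.
Proof. by rewrite mulr_ge0 ?addr_ge0 ?mulr_ge0. Qed.

Let sin1 t : `|sin t| <= 1.
Proof. by rewrite ler_norml sin_geN1 sin_le1. Qed.

Let cos1 t : `|cos t| <= 1.
Proof. by rewrite ler_norml cos_geN1 cos_le1. Qed.

Lemma rot_osc_le m k t : `|rot_osc m k t| <= rot_bound m k.
Proof.
apply: (@le_trans _ _ (1 * (1 * `|rot_plane m k : R| + 1 * `|rot_gen m k : R|))).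
  rewrite mul1r; apply: le_trans (ler_normB _ _) _.
  by rewrite !normrM lerD// ler_wpM2r.
rewrite ler_pM ?addr_ge0 ?mulr_ge0 ?lerDl// !mul1r lerD2l.
by rewrite ler_peMl// ler1n.
Qed.

Lemma rot_prim_le m k t : `|rot_prim m k t| <= rot_bound m k.
Proof.
rewrite normrM /rot_bound ler_pM ?lerDr//.
apply: le_trans (ler_normD _ _) _; rewrite !normrM lerD//.
  by rewrite ler_piMl.
rewrite ler_wpM2r//; apply: le_trans (ler_normB _ _) _; rewrite normr1.
by have := cos1 (rho * t); lra.
Qed.

Lemma Gamma_ev x t j k : 0 < t -> k != 0 -> Gamma tau rho x 0 t j k =
  \sum_m ev (oseen_path tau x t) t (stokes_symbol j m) * rot_osc m k t.
Proof.
move=> t0 k0; rewrite /Gamma mulmx0 subr0 mxE; apply: eq_bigr => m _.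
by rewrite Tstokes_ev// mexp_Omega rot_entry_osc.
Qed.

Lemma integrable_fsum n (f : 'I_n -> R -> R) :
  (forall p, mu.-integrable halfline (EFin \o f p)) ->
  mu.-integrable halfline (EFin \o (fun t => \sum_p f p t)).
Proof.
elim: n f => [|n IH] f If.
  have -> : (fun t => \sum_(p < 0) f p t) = cst 0 by apply/funext => t; rewrite big_ord0.
  exact: integrable0.
have -> : EFin \o (fun t => \sum_(p < n.+1) f p t) =
    (EFin \o (fun t => \sum_(p < n) f (lift ord0 p) t)) \+ (EFin \o f ord0).
  by apply/funext => t; rewrite /= big_ord_recl addrC.
by apply: integrableD => //; exact: IH.
Qed.

Lemma Rintegral_fsum n (f : 'I_n -> R -> R) :
  (forall p, mu.-integrable halfline (EFin \o f p)) ->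
  \int[mu]_(t in halfline) (\sum_p f p t) = \sum_p \int[mu]_(t in halfline) f p t.
Proof.
elim: n f => [|n IH] f If.
  by rewrite big_ord0; under eq_Rintegral do rewrite big_ord0; rewrite Rintegral_cst// mul0r.
rewrite big_ord_recl -IH//; under eq_Rintegral do rewrite big_ord_recl.
by rewrite RintegralD//; exact: integrable_fsum.
Qed.

Definition osc_integral e m k x : R :=
  \int[mu]_(t in halfline) (ev (oseen_path tau x t) t e * rot_prim m k t).

Let S x : R := (Num.sqrt (wake_size x))^-1.
Let H x := lorentz (wake_size x) tau (enorm x).

Let A_gt0 x : r0 <= enorm x -> 0 < wake_size x.
Proof. by move=> rx; exact: lt_le_trans r00 (wake_size_ge r0 x rx). Qed.

Let S_ge0 x : 0 <= S x.
Proof. by rewrite invr_ge0 sqrtr_ge0. Qed.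

(** Needed on an interval of h, not only at h = 0: the right-hand side can then be differentiated in
    place of [Z], even if the displaced point has norm below r0. *)
Lemma Z_osc x l h j k : k != 0 -> r0 <= enorm x -> near_line tau r0 x h ->
  Z tau rho j k (x + h *: delta_mx l 0) 0 =
  - \sum_m osc_integral (drift tau (stokes_symbol j m)) m k (x + h *: delta_mx l 0).
Proof.
move=> k0 rx hx; have A0 := A_gt0 x rx.
pose X := x + h *: delta_mx l 0.
pose U m t := ev (oseen_path tau X t) t (stokes_symbol j m).
pose dU m t := ev (oseen_path tau X t) t (drift tau (stokes_symbol j m)).
have UB m : exists2 C, 0 <= C &
    forall t, 0 < t -> `|U m t| <= C * H x t /\ `|dU m t| <= C * H x t.
  have hs := homog_stokes_symbol (R := R) j m.
  have [C C0 HC] := path_bound tau r0 tau0 r00 1 _ hs.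
  have [D D0 HD] := drift_bound tau r0 tau0 r00 2 _ hs.
  exists (C * S x ^+ 1 + D * S x ^+ 2); first by rewrite addr_ge0 ?mulr_ge0 ?exprn_ge0.
  move=> t t0; have h0 := ltW (lorentz_gt0 _ tau (enorm x) A0 t); split.
    apply: le_trans (HC x l h t rx hx t0) _; rewrite ler_wpM2r// lerDl.
    by rewrite mulr_ge0 ?exprn_ge0.
  apply: le_trans (HD x l h t rx hx t0) _; rewrite ler_wpM2r// lerDr.
  by rewrite mulr_ge0 ?exprn_ge0.
have U' m t : 0 < t -> has_deriv (U m) t (dU m t) by exact: has_deriv_path.
have cdU m t : 0 < t -> {for t, continuous (dU m)} by exact: continuous_path.
have IU m : mu.-integrable halfline (EFin \o (fun t => U m t * rot_osc m k t)).
  have [C C0 HC] := UB m.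
  have UC t : 0 < t -> `|U m t| <= C * H x t by move=> /HC[].
  exact: (integrable_Uw _ _ _ _ tau (enorm x) C _ A0 tau0 (U' m)
    (continuous_rot_osc m k) UC (rot_osc_le m k)).
transitivity (\int[mu]_(t in halfline) (\sum_m U m t * rot_osc m k t)).
  by apply: eq_Rintegral => t /set_mem /halflineP t0; exact: Gamma_ev.
rewrite Rintegral_fsum// -sumrN; apply: eq_bigr => m _.
have [C C0 HC] := UB m.
have UC t : 0 < t -> `|U m t| <= C * H x t by move=> /HC[].
have dUC t : 0 < t -> `|dU m t| <= C * H x t by move=> /HC[].
exact: (oscillation_by_parts (U m) (dU m) (rot_prim m k) (rot_osc m k)
  (wake_size x) tau (enorm x) C (rot_bound m k) A0 tau0 C0 (rot_bound_ge0 m k)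
  (U' m) (cdU m) (has_deriv_rot_prim m k) (continuous_rot_osc m k)
  (rot_prim0 m k) UC dUC (rot_osc_le m k) (rot_prim_le m k)).
Qed.

Lemma continuous_osc_integrand e m k x t : 0 < t ->
  {for t, continuous (fun t => ev (oseen_path tau x t) t e * rot_prim m k t)}.
Proof.
move=> t0; apply: cvgM; first exact: continuous_path.
exact: has_deriv_continuous (has_deriv_rot_prim m k t).
Qed.

Definition line_decay n e : Prop := exists2 C : R, 0 <= C &
  forall x l h t, r0 <= enorm x -> near_line tau r0 x h -> 0 < t ->
  `|ev (oseen_path tau (x + h *: delta_mx l 0) t) t e| <= C * S x ^+ n * H x t.

Lemma near_line0 x : r0 <= enorm x -> near_line tau r0 x 0.
Proof.
move=> rx; rewrite /near_line expr0n /= mulr0 mulr_ge0// ?ltW ?A_gt0//.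
exact: path_cst_gt0.
Qed.

Lemma osc_dominated C n e m k x l h :
  (forall t, 0 < t ->
    `|ev (oseen_path tau (x + h *: delta_mx l 0) t) t e| <= C * S x ^+ n * H x t) ->
  forall t, 0 < t ->
  `|ev (oseen_path tau (x + h *: delta_mx l 0) t) t e * rot_prim m k t| <=
    C * S x ^+ n * rot_bound m k * H x t.
Proof.
move=> HC t t0; rewrite normrM mulrAC ler_pM ?rot_prim_le//; exact: HC.
Qed.

(** The additional power of [S x] is the integral of the Lorentzian. *)
Lemma osc_integral_bound n e m k : line_decay n e -> exists2 C : R, 0 <= C &
  forall x, r0 <= enorm x -> `|osc_integral e m k x| <= C * S x ^+ n.+1.
Proof.
move=> [C C0 HC]; exists (C * rot_bound m k * (pi / tau)).
  by rewrite !mulr_ge0 ?rot_bound_ge0 ?pi_ge0 ?invr_ge0 ?(ltW tau0).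
move=> x rx; have A0 := A_gt0 x rx.
have D := osc_dominated C n e m k x 0 0 (fun t pt => HC x 0 0 t rx (near_line0 x rx) pt).
rewrite scale0r addr0 in D.
have B0 : 0 <= C * S x ^+ n * rot_bound m k.
  by rewrite !mulr_ge0 ?exprn_ge0 ?rot_bound_ge0.
have M : measurable_fun halfline (fun t => ev (oseen_path tau x t) t e * rot_prim m k t).
  by apply: measurable_halfline => t; exact: continuous_osc_integrand.
apply: le_trans (Rintegral_dominated _ tau (enorm x) A0 tau0 _ M B0 D) _.
rewrite invfM -/(S x) exprSr; rewrite le_eqVlt; apply/orP; left; apply/eqP; ring.
Qed.

Lemma has_deriv_osc_integral p n e m k x i : line_decay p e -> line_decay n (Dx i e) ->
  r0 <= enorm x ->
  has_deriv (fun h => osc_integral e m k (x + h *: delta_mx i 0)) 0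
    (osc_integral (Dx i e) m k x).
Proof.
move=> [B B0 HB] [C C0 HC] rx; have A0 := A_gt0 x rx.
have c0 := path_cst_gt0 tau r0 tau0 r00.
pose f h t := ev (oseen_path tau (x + h *: delta_mx i 0) t) t e * rot_prim m k t.
pose df h t := ev (oseen_path tau (x + h *: delta_mx i 0) t) t (Dx i e) * rot_prim m k t.
have dfE h t : 0 < t -> has_deriv (f ^~ t) h (df h t).
  move=> t0; apply: has_deriv_eq.
    apply: has_derivM _ (has_deriv_cst _ _).
    have -> : (fun h => ev (oseen_path tau (x + h *: delta_mx i 0) t) t e) =
        (fun h => ev (oseen_path tau x t + h *: delta_mx i 0) t e).
      by apply/funext => u; rewrite path_line.
    exact: has_deriv_ev_line.
  by rewrite mulr0 addr0 /df path_line.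
(* The radius at which [near_line] becomes an equality. *)
pose d := Num.sqrt (path_cst tau r0 * wake_size x) / 2.
have cA : 0 < path_cst tau r0 * wake_size x by rewrite mulr_gt0.
have d0 : 0 < d by rewrite divr_gt0// sqrtr_gt0.
have near_d h : `]-d, d[%classic h -> near_line tau r0 x h.
  rewrite /= in_itv/= => /andP[h1 h2]; rewrite /near_line.
  have -> : path_cst tau r0 * wake_size x = (2 * d) ^+ 2.
    have -> : 2 * d = Num.sqrt (path_cst tau r0 * wake_size x) by rewrite /d; field.
    by rewrite sqr_sqrtr// ltW.
  nra.
have mf h : measurable_fun halfline (f h).
  by apply: measurable_halfline => t; exact: continuous_osc_integrand.
(* The majorant is centred at x for all |h| < d, hence independent of h, as dominated
   differentiation requires. *)
pose G t := C * S x ^+ n * rot_bound m k * H x t.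
have BH t : 0 <= H x t by exact/ltW/lorentz_gt0.
have K := @cvg_differentiation_under_integral R _ _ mu f halfline (measurable_itv _) 0 (-d) d.
have {}K := K _ _ _ G _ _ _.
have E h : osc_integral e m k (x + h *: delta_mx i 0) = \int[mu]_(t in halfline) f h t by [].
have L : h^-1 *: (osc_integral e m k (x + (h + 0) *: delta_mx i 0) -
    osc_integral e m k (x + 0 *: delta_mx i 0)) @[h --> 0^'] --> osc_integral (Dx i e) m k x.
  have -> : osc_integral (Dx i e) m k x = \int[mu]_(t in halfline) (partial1of2 f 0 t).
    apply: eq_Rintegral => t /set_mem /halflineP t0.
    by rewrite partial1of2E (has_deriv_derive (dfE 0 t t0)) /df scale0r addr0.
  apply: K.
  - by rewrite /= in_itv/= oppr_lt0 d0.
  - move=> h /near_d hx; apply: (integrable_dominated _ tau (enorm x) A0 tau0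
      (B * S x ^+ p * rot_bound m k) (mf h)).
    by apply: osc_dominated => t; exact: HB.
  - by move=> h t _ /halflineP t0; exact: has_deriv_derivable (dfE h t t0).
  - by move=> t; rewrite !mulr_ge0 ?exprn_ge0 ?rot_bound_ge0.
  - exact: (@integrableZl _ _ _ mu _ _ (C * S x ^+ n * rot_bound m k) _
      (integrable_lorentz _ tau (enorm x) A0 tau0)).
  - move=> h t /near_d hx /halflineP t0.
    rewrite partial1of2E (has_deriv_derive (dfE h t t0)).
    by apply: (osc_dominated C n (Dx i e) m k x i h _ t t0) => s; exact: HC.
have E' : (fun h => h^-1 *: (((fun h => osc_integral e m k (x + h *: delta_mx i 0)) \o shift 0)
    (h *: 1) - osc_integral e m k (x + 0 *: delta_mx i 0))) =
  (fun h => h^-1 *: (osc_integral e m k (x + (h + 0) *: delta_mx i 0) -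
    osc_integral e m k (x + 0 *: delta_mx i 0))).
  by apply/funext => h; rewrite /= [h *: 1]mulr1.
split; first by rewrite /derivable E'; apply/cvg_ex; eexists; exact: L.
by rewrite /derive E'; exact: cvg_lim L.
Qed.

Lemma near_line_near x : r0 <= enorm x -> \forall h \near (0 : R), near_line tau r0 x h.
Proof.
move=> rx; have cA : 0 < path_cst tau r0 * wake_size x.
  by rewrite mulr_gt0 ?path_cst_gt0 ?A_gt0.
have : 4 * h ^+ 2 @[h --> (0 : R)] --> (0 : R).
  rewrite -[X in _ --> X](mulr0 4); apply: cvgM; first exact: cvg_cst.
  by have := @exprn_continuous R 2 0; rewrite /continuous_at expr0n.
move/cvgr_lt => /(_ _ cA); apply: filterS => h; exact: ltW.
Qed.

Lemma line_decay_drift j m : line_decay 2 (drift tau (stokes_symbol j m)).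
Proof. exact: drift_bound (homog_stokes_symbol j m). Qed.

Lemma line_decay_Dx_drift i j m : line_decay 3 (Dx i (drift tau (stokes_symbol j m))).
Proof. exact: Dx_drift_bound (homog_stokes_symbol j m). Qed.

Lemma partial_Z i j k x : k != 0 -> r0 <= enorm x ->
  partial i (fun z => Z tau rho j k z 0) x =
  - \sum_m osc_integral (Dx i (drift tau (stokes_symbol j m))) m k x.
Proof.
move=> k0 rx; apply: derive_line.
have D : has_deriv (fun h => - \sum_m osc_integral (drift tau (stokes_symbol j m)) m k
    (x + h *: delta_mx i 0)) 0
  (- \sum_m osc_integral (Dx i (drift tau (stokes_symbol j m))) m k x).
  apply: has_derivN; apply: (has_deriv_sum 3 (fun m h => osc_integral
    (drift tau (stokes_symbol j m)) m k (x + h *: delta_mx i 0))) => m.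
  apply: has_deriv_osc_integral rx; [exact: line_decay_drift|exact: line_decay_Dx_drift].
apply: near_eq_is_derive D; have := near_line_near x rx.
by apply: filterS => h hx; rewrite Z_osc.
Qed.

Lemma sum_osc_bound n k (e : 'I_3 -> symbol R) : (forall m, line_decay n (e m)) ->
  exists2 C : R, 0 <= C & forall x, r0 <= enorm x ->
    `|- \sum_m osc_integral (e m) m k x| <= C * S x ^+ n.+1.
Proof.
move=> he.
have /choice[C HC] : forall m, exists C : R, 0 <= C /\ forall x, r0 <= enorm x ->
    `|osc_integral (e m) m k x| <= C * S x ^+ n.+1.
  by move=> m; have [C C0 ?] := osc_integral_bound n (e m) m k (he m); exists C.
exists (\sum_m C m); first by apply: sumr_ge0 => m _; case: (HC m).
move=> x rx; rewrite normrN mulr_suml; apply: le_trans (ler_norm_sum _ _ _) _.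
by apply: ler_sum => m _; case: (HC m) => _; exact.
Qed.

Lemma Z_bound j k : k != 0 -> exists2 C : R, 0 <= C & forall x, r0 <= enorm x ->
  `|Z tau rho j k x 0| <= C * S x ^+ 3.
Proof.
move=> k0; have [C C0 HC] := sum_osc_bound 2 k _ (line_decay_drift j).
exists C => // x rx; have := Z_osc x 0 0 j k k0 rx (near_line0 x rx).
by rewrite scale0r addr0 => ->; exact: HC.
Qed.

Lemma partial_Z_bound i j k : k != 0 -> exists2 C : R, 0 <= C & forall x, r0 <= enorm x ->
  `|partial i (fun z => Z tau rho j k z 0) x| <= C * S x ^+ 4.
Proof.
move=> k0; have [C C0 HC] := sum_osc_bound 3 k _ (line_decay_Dx_drift i j).
by exists C => // x rx; rewrite partial_Z//; exact: HC.
Qed.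

Lemma wake_size_powR n x : r0 <= enorm x ->
  wake_size x `^ (- (3 / 2) - n%:R / 2) = S x ^+ (3 + n).
Proof.
move=> /A_gt0 A0; have -> : - (3 / 2) - n%:R / 2 = - (2^-1 * (3 + n)%:R) :> R.
  by rewrite natrD; field.
by rewrite powRN powRrM powR12_sqrt ?ltW// powR_mulrn ?sqrtr_ge0// exprVn.
Qed.

End Oseen.

Lemma mabs_le1 (alpha : 'I_3 -> nat) : (mabs alpha <= 1)%N ->
  (forall l, alpha l = 0%N) \/ exists i, forall l, alpha l = (l == i).
Proof.
rewrite /mabs => a1.
have [/eqP/[!sum_nat_eq0]/forallP a0|an0] := eqVneq (\sum_l alpha l)%N 0%N.
  by left=> l; have /eqP := a0 l.
right; have : exists i, alpha i != 0%N.
  apply/existsP; rewrite -negb_forall; apply: contra an0 => /forallP a0.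
  by apply/eqP; rewrite big1// => l _; exact/eqP/a0.
move=> [i ai]; exists i => l; move: a1; rewrite (bigD1 i)//=.
have [->|li] := eqVneq l i; first by lia.
rewrite (bigD1 l)//=; lia.
Qed.

Theorem theorem5p1 (R : realType) (tau rho S : R) (htau : 0 < tau)
    (hrho : rho != 0) (hS : 2 * tau * pi / `|rho| <= S) :
  exists C : R, 0 < C /\
    forall (x : 'cV[R]_3) (alpha : 'I_3 -> nat) (j k : 'I_3),
      S + tau * pi / `|rho| <= enorm x ->
      (mabs alpha <= 1)%N ->
      k != 0 ->
      `|mpartial alpha (fun z => Z tau rho j k z 0) x| <=
        C * (enorm x * wake x) `^ (- (3 / 2) - (mabs alpha)%:R / 2).
Proof.
pose r0 := S + tau * pi / `|rho|.
have r00 : 0 < r0.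
  have p0 : 0 < tau * pi / `|rho| by rewrite divr_gt0 ?mulr_gt0 ?pi_gt0 ?normr_gt0.
  have : 2 * tau * pi / `|rho| = 2 * (tau * pi / `|rho|) by rewrite !mulrA.
  by rewrite /r0; lra.
pose s (x : 'cV[R]_3) := (Num.sqrt (wake_size x))^-1.
(* The bounds come with a constant for each choice of indices, set to 0 for the excluded k; their
   sum, plus 1 for strict positivity, serves all of them at once. *)
have /choice[C HC] : forall p : 'I_3 * 'I_3, exists C : R, 0 <= C /\ (p.2 != 0 ->
    forall x, r0 <= enorm x -> `|Z tau rho p.1 p.2 x 0| <= C * s x ^+ 3).
  move=> [j k] /=; have [->|k0] := eqVneq k 0; first by exists 0.
  by have [C C0 HC] := Z_bound tau rho r0 htau hrho r00 j k k0; exists C.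
have /choice[D HD] : forall p : 'I_3 * 'I_3 * 'I_3, exists D : R, 0 <= D /\ (p.2 != 0 ->
    forall x, r0 <= enorm x ->
    `|partial p.1.1 (fun z => Z tau rho p.1.2 p.2 z 0) x| <= D * s x ^+ 4).
  move=> [[i j] k] /=; have [->|k0] := eqVneq k 0; first by exists 0.
  by have [D D0 HD] := partial_Z_bound tau rho r0 htau hrho r00 i j k k0; exists D.
have sC : 0 <= \sum_p C p by apply: sumr_ge0 => p _; case: (HC p).
have sD : 0 <= \sum_p D p by apply: sumr_ge0 => p _; case: (HD p).
have CS p : C p <= \sum_p C p.
  by rewrite (bigD1 p)//= lerDl sumr_ge0// => q _; case: (HC q).
have DS p : D p <= \sum_p D p.
  by rewrite (bigD1 p)//= lerDl sumr_ge0// => q _; case: (HD q).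
exists (1 + \sum_p C p + \sum_p D p); split; first by rewrite -addrA ltr_pwDl// addr_ge0.
move=> x alpha j k rx /[dup] a1 /mabs_le1 ha k0.
rewrite -/(wake_size x) (wake_size_powR r0)// -/(s x).
have s0 : 0 <= s x by rewrite invr_ge0 sqrtr_ge0.
case: ha => [a0|[i ai]].
  have -> : mabs alpha = 0%N by rewrite /mabs big1.
  rewrite /mpartial !a0 /=; have [_ /(_ k0 x rx) B] := HC (j, k).
  apply: le_trans B _; rewrite ler_wpM2r ?exprn_ge0//.
  by have := CS (j, k); lra.
have -> : mabs alpha = 1%N.
  by rewrite /mabs (bigD1 i)//= ai eqxx big1// => l /negbTE li; rewrite ai li.
have -> : mpartial alpha (fun z => Z tau rho j k z 0) x =
    partial i (fun z => Z tau rho j k z 0) x.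
  rewrite /mpartial !ai.
  by case: i {ai} => [[|[|[|//]]] ?]; congr (partial _ _ _); apply: val_inj.
have [_ /(_ k0 x rx) B] := HD (i, j, k).
apply: le_trans B _; rewrite ler_wpM2r ?exprn_ge0//.
by have := DS (i, j, k); lra.
Qed.
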